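(* Let $p_i,q_i,r_i\in\mathbb{C}\{x,u\}$ ($1\le i\le 3$) and consider the system of linear partial differential equations for an unknown function $z(x,u)$ $$\begin{aligned} z^{(2,0)}+p_3z^{(1,0)}+q_3z^{(0,1)}+r_3z&=0\\ z^{(1,1)}+p_2z^{(1,0)}+q_2z^{(0,1)}+r_2z&=0\\ z^{(0,2)}+p_1z^{(1,0)}+q_1z^{(0,1)}+r_1z&=0,\end{aligned}\qquad z^{(l,j)}=\frac{\partial^{l+j}z}{\partial x^l\partial u^j}.$$ Then one can associate to this system a vector bundle of rank three with connection on $(\mathbb{C}^2,O)$, where $O\in\mathbb{C}^2$ is a fixed point, namely the bundle with connection $(R_0,\nabla_0)$ described in the context. This connection is flat if and only if the system satisfies all its six integrability conditions. Moreover, when the connection is flat, its sheaf of horizontal sections is a local system of rank three isomorphic to the solution space of the system.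
   Context: Let $\mathcal{O}=\mathbb{C}\{x,u\}$ be the ring of germs of holomorphic functions at $O$ in the coordinates $(x,u)$ of $\mathbb{C}^2$, and let $\Omega^1=\mathcal{O}\,dx\oplus\mathcal{O}\,du$. Jets. $J_2(\mathcal{O})$ is the free $\mathcal{O}$-module of rank 6 of second order jets of functions, with coordinates $(z,p,q,r,s,t)$ corresponding to $(z,z_x,z_u,z_{xx},z_{xu},z_{uu})$. $J_1(\mathcal{O})$ is the free $\mathcal{O}$-module of rank 3 of first order jets, with coordinates $(z,p,q)$ corresponding to $(z,z_x,z_u)$. The Spencer operator is the $\mathbb{C}$-linear map $D:J_2(\mathcal{O})\to\Omega^1\otimes_{\mathcal{O}}J_1(\mathcal{O})$, $$D(z,p,q,r,s,t)=dx\otimes(\partial_xz-p,\ \partial_xp-r,\ \partial_xq-s)+du\otimes(\partial_uz-q,\ \partial_up-s,\ \partial_uq-t).$$ The bundle with connection. $R_0\subset J_2(\mathcal{O})$ is the $\mathcal{O}$-submodule defined by the system, i.e. the kernel of $$(z,p,q,r,s,t)\mapsto(r+p_3p+q_3q+r_3z,\ s+p_2p+q_2q+r_2z,\ t+p_1p+q_1q+r_1z).$$ It is free of rank 3, and the projection $\overline{\pi}_{-1}:R_0\to J_1(\mathcal{O})$, $(z,p,q,r,s,t)\mapsto(z,p,q)$, is an isomorphism. The associated connection is $$\nabla_0:=(\mathrm{Id}_{\Omega^1}\otimes\overline{\pi}_{-1}^{-1})\circ D:R_0\to\Omega^1\otimes_{\mathcal{O}}R_0 .$$ A section is horizontal if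 it lies in $\ker\nabla_0$. Integrability conditions. The six integrability conditions of the system are obtained as follows. In each of the two compatibility relations $\partial_u(z^{(2,0)})=\partial_x(z^{(1,1)})$ and $\partial_x(z^{(0,2)})=\partial_u(z^{(1,1)})$, use the system to replace all second order derivatives, so that each relation becomes a linear relation among $z,z^{(1,0)},z^{(0,1)}$ with coefficients in $\mathcal{O}$. The conditions are that the three coefficients of $z$, $z^{(1,0)}$, $z^{(0,1)}$ in each of the two relations vanish identically. *)

(* Defs.v *)
From HB Require Import structures.
From mathcomp Require Import all_boot all_order all_algebra.
From mathcomp Require Import all_classical all_reals all_analysis.
From mathcomp Require Import complex ring.
Set Implicit Arguments.
Unset Strict Implicit.
Unset Printing Implicit Defensive.
Import Order.TTheory GRing.Theory Num.Theory.
Import numFieldNormedType.Exports.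
Local Open Scope classical_set_scope.
Local Open Scope ring_scope.

(** * The ring K{x,u} of convergent power series in two variables

  [K] will be the field of complex numbers.  Following the notation
  C{x,u}, a germ of holomorphic function at the origin is its convergent
  Taylor series; the relation [has_germ] below ties such a series to honest
  functions on open sets of C^2. *)

Section ConvergentSeries.
Variable K : numFieldType.
Implicit Types a b c : nat -> nat -> K.

(* Cauchy's estimates: absolute convergence on some polydisc around 0. *)
Definition convergent a :=
  exists M L : K, forall i j, `|a i j| <= M * L ^+ (i + j).

Lemma convergentP a : convergent a ->
  exists M L : K, [/\ 0 <= M, 1 <= L & forall i j, `|a i j| <= M * L ^+ (i + j)].
Proof.
move=> [M [L aML]]; exists `|M|, (1 + `|L|); split => //.
- by rewrite lerDl.
- move=> i j; apply: le_trans (aML i j) _.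
  rewrite -[M * _]ger0_norm ?(le_trans _ (aML i j)) //.
  rewrite normrM normrX ler_wpM2l // lerXn2r // ?nnegrE ?addr_ge0 //.
  by rewrite lerDr.
Qed.

Record germ := Germ {
  coefs :> nat -> nat -> K;
  coefs_convergent : convergent coefs }.

Lemma germ_eq (f g : germ) : (forall i j, f i j = g i j) -> f = g.
Proof.
case: f g => [a ca] [b cb] /= ab.
have {}ab : a = b by apply/funext => i; apply/funext => j.
by case: _ / ab cb => cb; congr Germ; exact: Prop_irrelevance.
Qed.

HB.instance Definition _ := gen_eqMixin germ.
HB.instance Definition _ := gen_choiceMixin germ.

Lemma convergent_cst k :
  convergent (fun i j => if (i + j == 0)%N then k else 0).
Proof.
exists `|k|, 1 => i j; rewrite expr1n mulr1.
by case: ifP => // _; rewrite normr0.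
Qed.
Definition cst_germ k := Germ (convergent_cst k).

Lemma convergent_add a b : convergent a -> convergent b ->
  convergent (fun i j => a i j + b i j).
Proof.
move=> /convergentP[M [L [M0 L1 aML]]] /convergentP[N [P [N0 P1 bNP]]].
exists (M + N), (L * P) => i j.
have L0 : 0 <= L by exact: le_trans L1.
have P0 : 0 <= P by exact: le_trans P1.
apply: le_trans (ler_normD _ _) _; rewrite mulrDl exprMn lerD //.
- apply: le_trans (aML i j) _; rewrite ler_wpM2l // ler_peMr ?exprn_ge0 //.
  exact: exprn_ege1.
- apply: le_trans (bNP i j) _; rewrite ler_wpM2l // ler_peMl ?exprn_ge0 //.
  exact: exprn_ege1.
Qed.
Definition add_germ (f g : germ) :=
  Germ (convergent_add (coefs_convergent f) (coefs_convergent g)).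

Lemma convergent_scale k a : convergent a -> convergent (fun i j => k * a i j).
Proof.
move=> [M [L aML]]; exists (`|k| * M), L => i j.
by rewrite normrM -mulrA ler_wpM2l.
Qed.
Definition scale_germ k (f : germ) :=
  Germ (convergent_scale k (coefs_convergent f)).

Lemma convergent_opp a : convergent a -> convergent (fun i j => - a i j).
Proof. by move=> [M [L aML]]; exists M, L => i j; rewrite normrN. Qed.
Definition opp_germ (f : germ) := Germ (convergent_opp (coefs_convergent f)).

Definition cauchy a b i j :=
  \sum_(k < i.+1) \sum_(l < j.+1) a k l * b (i - k)%N (j - l)%N.

Lemma natr_le_exp2 n : n.+1%:R <= 2 ^+ n :> K.
Proof. by rewrite -natrX ler_nat; exact: ltn_expl. Qed.

Lemma convergent_mul a b : convergent a -> convergent b ->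
  convergent (cauchy a b).
Proof.
move=> /convergentP[M [L [M0 L1 aML]]] /convergentP[N [P [N0 P1 bNP]]].
have L0 : 0 <= L by exact: le_trans L1.
have P0 : 0 <= P by exact: le_trans P1.
exists (M * N), (2 * (L * P)) => i j.
have bound k l : (k <= i)%N -> (l <= j)%N ->
    `|a k l * b (i - k)%N (j - l)%N| <= M * N * (L * P) ^+ (i + j).
  move=> ki lj; rewrite normrM exprMn mulrACA ler_pM //.
  - apply: le_trans (aML k l) _; rewrite ler_wpM2l // ler_weXn2l //.
    exact: leq_add.
  - apply: le_trans (bNP _ _) _; rewrite ler_wpM2l // ler_weXn2l //.
    by apply: leq_add; exact: leq_subr.
apply: le_trans (_ : \sum_(k < i.+1) \sum_(l < j.+1)
    M * N * (L * P) ^+ (i + j) <= _).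
  apply: le_trans (ler_norm_sum _ _ _) _; apply: ler_sum => k _.
  apply: le_trans (ler_norm_sum _ _ _) _; apply: ler_sum => l _.
  by apply: bound; rewrite -ltnS ltn_ord.
rewrite !sumr_const !card_ord -mulrnA -[leLHS]mulr_natr -[leLHS]mulrA.
rewrite [(2 * _) ^+ _]exprMn [X in _ <= _ * X]mulrC.
rewrite ler_wpM2l ?mulr_ge0 // ler_wpM2l ?exprn_ge0 ?mulr_ge0 //.
by rewrite natrM exprD mulrC ler_pM ?ler0n ?natr_le_exp2.
Qed.
Definition mul_germ (f g : germ) :=
  Germ (convergent_mul (coefs_convergent f) (coefs_convergent g)).

(* The ring laws are transported from polynomials by truncation. *)
Definition trunc2 n a : {poly {poly K}} := \poly_(i < n) \poly_(j < n) a i j.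

Lemma coef_trunc2 n a i j : (i < n)%N -> (j < n)%N -> (trunc2 n a)`_i`_j = a i j.
Proof. by move=> lin ljn; rewrite coef_poly lin coef_poly ljn. Qed.

Lemma coef_mul2 (p q : {poly {poly K}}) i j : (p * q)`_i`_j =
  \sum_(k < i.+1) \sum_(l < j.+1) p`_k`_l * q`_(i - k)`_(j - l).
Proof.
rewrite coefM coef_sum; apply: eq_bigr => k _; exact: coefM.
Qed.

Lemma eq_cauchy a a' b b' i j :
  (forall k l, (k <= i)%N -> (l <= j)%N -> a k l = a' k l) ->
  (forall k l, (k <= i)%N -> (l <= j)%N -> b k l = b' k l) ->
  cauchy a b i j = cauchy a' b' i j.
Proof.
move=> aa' bb'; apply: eq_bigr => k _; apply: eq_bigr => l _.
by rewrite aa' ?bb' ?leq_subr // -ltnS ltn_ord.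
Qed.

Lemma cauchyE n a b i j : (i < n)%N -> (j < n)%N ->
  cauchy a b i j = (trunc2 n a * trunc2 n b)`_i`_j.
Proof.
move=> lin ljn; rewrite coef_mul2.
apply: (@eq_cauchy _ (fun k l => (trunc2 n a)`_k`_l)
                   _ (fun k l => (trunc2 n b)`_k`_l)) => k l ki lj;
  by rewrite coef_trunc2 // ?(leq_ltn_trans ki) ?(leq_ltn_trans lj).
Qed.

Lemma cauchyA a b c i j : cauchy a (cauchy b c) i j = cauchy (cauchy a b) c i j.
Proof.
pose n := (i + j).+1.
have lin : (i < n)%N by rewrite ltnS leq_addr.
have ljn : (j < n)%N by rewrite ltnS leq_addl.
transitivity ((trunc2 n a * (trunc2 n b * trunc2 n c))`_i`_j).
  rewrite coef_mul2; apply: (@eq_cauchy _ (fun k l => (trunc2 n a)`_k`_l)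
    _ (fun k l => (trunc2 n b * trunc2 n c)`_k`_l)) => k l ki lj.
    by rewrite coef_trunc2 // ?(leq_ltn_trans ki) ?(leq_ltn_trans lj).
  by rewrite (@cauchyE n) // ?(leq_ltn_trans ki) ?(leq_ltn_trans lj).
rewrite mulrA coef_mul2; symmetry.
apply: (@eq_cauchy _ (fun k l => (trunc2 n a * trunc2 n b)`_k`_l)
  _ (fun k l => (trunc2 n c)`_k`_l)) => k l ki lj.
  by rewrite (@cauchyE n) // ?(leq_ltn_trans ki) ?(leq_ltn_trans lj).
by rewrite coef_trunc2 // ?(leq_ltn_trans ki) ?(leq_ltn_trans lj).
Qed.

Lemma cauchyC a b i j : cauchy a b i j = cauchy b a i j.
Proof.
pose n := (i + j).+1.
by rewrite !(@cauchyE n) ?ltnS ?leq_addr ?leq_addl // mulrC.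
Qed.

Lemma cauchy_cst k a i j :
  cauchy (fun i j => if (i + j == 0)%N then k else 0) a i j = k * a i j.
Proof.
rewrite /cauchy big_ord_recl [X in _ + X]big1 ?addr0; last first.
  by move=> l _; rewrite big1 // => m _; rewrite mul0r.
rewrite big_ord_recl [X in _ + X]big1 ?addr0 ?subn0 //.
by move=> l _; rewrite mul0r.
Qed.

Let addgA : associative add_germ.
Proof. by move=> f g h; apply: germ_eq => i j /=; rewrite addrA. Qed.
Let addgC : commutative add_germ.
Proof. by move=> f g; apply: germ_eq => i j /=; rewrite addrC. Qed.
Let add0g : left_id (cst_germ 0) add_germ.
Proof. by move=> f; apply: germ_eq => i j /=; rewrite if_same add0r. Qed.
Let addNg : left_inverse (cst_germ 0) opp_germ add_germ.
Proof. by move=> f; apply: germ_eq => i j /=; rewrite if_same addNr. Qed.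

HB.instance Definition _ := GRing.isZmodule.Build germ addgA addgC add0g addNg.

Let mulgA : associative mul_germ.
Proof. by move=> f g h; apply: germ_eq => i j; exact: cauchyA. Qed.
Let mulgC : commutative mul_germ.
Proof. by move=> f g; apply: germ_eq => i j; exact: cauchyC. Qed.
Let mul1g : left_id (cst_germ 1) mul_germ.
Proof.
by move=> f; apply: germ_eq => i j; rewrite [LHS]cauchy_cst mul1r.
Qed.
Let mulgDl : left_distributive mul_germ +%R.
Proof.
move=> f g h; apply: germ_eq => i j /=; rewrite /cauchy -big_split /=.
apply: eq_bigr => k _; rewrite -big_split /=; apply: eq_bigr => l _.
exact: mulrDl.
Qed.
Let oneg_neq0 : cst_germ 1 != 0.
Proof.
apply/eqP => /(congr1 (fun f : germ => f 0%N 0%N)) /= /eqP.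
by rewrite oner_eq0.
Qed.

HB.instance Definition _ :=
  GRing.Zmodule_isComNzRing.Build germ mulgA mulgC mul1g mulgDl oneg_neq0.

Let scalegA k l (f : germ) :
  scale_germ k (scale_germ l f) = scale_germ (k * l) f.
Proof. by apply: germ_eq => i j /=; rewrite mulrA. Qed.
Let scale1g : left_id 1 scale_germ.
Proof. by move=> f; apply: germ_eq => i j /=; rewrite mul1r. Qed.
Let scalegDr : right_distributive scale_germ +%R.
Proof. by move=> k f g; apply: germ_eq => i j /=; rewrite mulrDr. Qed.
Let scalegDl f : {morph scale_germ^~ f : k l / k + l}.
Proof. by move=> k l; apply: germ_eq => i j /=; rewrite mulrDl. Qed.

HB.instance Definition _ :=
  GRing.Zmodule_isLmodule.Build K germ scalegA scale1g scalegDr scalegDl.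

Let scalegAl k (f g : germ) : k *: (f * g) = (k *: f) * g.
Proof.
apply: germ_eq => i j /=; rewrite /cauchy mulr_sumr; apply: eq_bigr => m _.
by rewrite mulr_sumr; apply: eq_bigr => l _; rewrite mulrA.
Qed.

HB.instance Definition _ := GRing.Lmodule_isLalgebra.Build K germ scalegAl.

(** ** Partial derivatives *)

Lemma convergent_dx a : convergent a ->
  convergent (fun i j => i.+1%:R * a i.+1 j).
Proof.
move=> /convergentP[M [L [M0 L1 aML]]]; exists (M * L), (2 * L) => i j.
have L0 : 0 <= L by exact: le_trans L1.
rewrite normrM normr_nat exprMn mulrCA.
apply: ler_pM => //.
  apply: le_trans (natr_le_exp2 i) _.
  by rewrite ler_weXn2l ?ler1n // leq_addr.
by apply: le_trans (aML _ _) _; rewrite addSn exprS mulrA.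
Qed.
Definition dx (f : germ) := Germ (convergent_dx (coefs_convergent f)).

Lemma convergent_du a : convergent a ->
  convergent (fun i j => j.+1%:R * a i j.+1).
Proof.
move=> /convergentP[M [L [M0 L1 aML]]]; exists (M * L), (2 * L) => i j.
have L0 : 0 <= L by exact: le_trans L1.
rewrite normrM normr_nat exprMn mulrCA.
apply: ler_pM => //.
  apply: le_trans (natr_le_exp2 j) _.
  by rewrite ler_weXn2l ?ler1n // leq_addl.
by apply: le_trans (aML _ _) _; rewrite addnS exprS mulrA.
Qed.
Definition du (f : germ) := Germ (convergent_du (coefs_convergent f)).

(** ** Germs of functions

  [has_germ f a g]: near the point [a] of K^2 the function [f] is the sum of
  the convergent power series [g] in the coordinates centred at [a]; so [f] is
  holomorphic near [a], with germ [g] at [a]. *)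
Definition has_germ (f : K * K -> K) (a : K * K) (g : germ) : Prop :=
  \forall h \near (0 : K * K),
    (fun n : nat => \sum_(i < n) \sum_(j < n) g i j * h.1 ^+ i * h.2 ^+ j)
      @ \oo --> f (a + h).

Definition has_germs n (f : K * K -> 'rV[K]_n) (a : K * K) (g : 'rV[germ]_n) : Prop :=
  forall k, has_germ (fun y => f y 0 k) a (g 0 k).

End ConvergentSeries.

(** * Connections on modules over K{x,u}

  Omega^1 is free with basis (dx, du), so an element of Omega^1 (x) M is the
  pair of its coefficients along dx and du; likewise Omega^2 (x) M is M, along
  dx /\ du. *)

Section Connections.
Variables (K : numFieldType) (M : lmodType (germ K)).
Implicit Types (s : M) (nabla : M -> M * M).

Definition is_connection nabla :=
  {morph nabla : s t / s + t} /\
  forall (f : germ K) s, nabla (f *: s) = (dx f *: s, du f *: s) + f *: nabla s.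

(* The extension to 1-forms, nabla (w (x) s) = d w (x) s - w /\ nabla s. *)
Definition nabla1 nabla (w : M * M) : M := (nabla w.2).1 - (nabla w.1).2.

Definition curvature nabla s : M := nabla1 nabla (nabla s).

Definition flat nabla := forall s, curvature nabla s = 0.

Definition horizontal nabla s := nabla s = 0.

Definition free_of_rank n := exists phi : {linear 'rV[germ K]_n -> M}, bijective phi.

End Connections.

(** * The system and its bundle with connection *)

Record system (A : Type) := System {
  p1 : A; p2 : A; p3 : A;
  q1 : A; q2 : A; q3 : A;
  r1 : A; r2 : A; r3 : A }.

Section BundleOfSystem.
Variables (K : numFieldType) (S : system (germ K)).
Local Notation O := (germ K).

Definition is_solution (z : O) :=
  [/\ dx (dx z) + p3 S * dx z + q3 S * du z + r3 S * z = 0,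
      dx (du z) + p2 S * dx z + q2 S * du z + r2 S * z = 0 &
      du (du z) + p1 S * dx z + q1 S * du z + r1 S * z = 0].

(* J_2 is 'rV[O]_6 with coordinates 0, ..., 5 = z, p, q, r, s, t;
   J_1 is 'rV[O]_3 with coordinates 0, 1, 2 = z, p, q. *)
Definition mkrow n (l : seq O) : 'rV[O]_n := \row_k l`_k.

Definition spencer (v : 'rV[O]_6) : 'rV[O]_3 * 'rV[O]_3 :=
  (mkrow 3 [:: dx (v 0 0) - v 0 1; dx (v 0 1) - v 0 3; dx (v 0 2) - v 0 4],
   mkrow 3 [:: du (v 0 0) - v 0 2; du (v 0 1) - v 0 4; du (v 0 2) - v 0 5]).

Definition sysmap (v : 'rV[O]_6) : 'rV[O]_3 :=
  mkrow 3 [:: v 0 3 + p3 S * v 0 1 + q3 S * v 0 2 + r3 S * v 0 0;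
              v 0 4 + p2 S * v 0 1 + q2 S * v 0 2 + r2 S * v 0 0;
              v 0 5 + p1 S * v 0 1 + q1 S * v 0 2 + r1 S * v 0 0].

Lemma sysmap_linear a : {morph sysmap : u v / a *: u + v}.
Proof.
move=> u v; apply/rowP; case=> [[|[|[|//]]] lt_k3]; rewrite !mxE /= ?mxE; ring.
Qed.

Definition R0_pred : {pred 'rV[O]_6} := fun v => sysmap v == 0.

Lemma R0_submod_closed : submod_closed R0_pred.
Proof.
split=> [|a u v /eqP u0 /eqP v0]; last first.
  by apply/eqP; rewrite sysmap_linear u0 v0 scaler0 addr0.
apply/eqP/rowP; case=> [[|[|[|//]]] lt_k3]; rewrite !mxE /= ?mxE; ring.
Qed.

HB.instance Definition _ :=
  GRing.isSubmodClosed.Build O 'rV[O]_6 R0_pred R0_submod_closed.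

Record R0 := MkR0 { jet :> 'rV[O]_6; jetP : jet \in R0_pred }.
HB.instance Definition _ := [isSub for jet].
HB.instance Definition _ := [Choice of R0 by <:].
HB.instance Definition _ := [SubChoice_isSubLmodule of R0 by <:].

Definition pi_ (v : R0) : 'rV[O]_3 := mkrow 3 [:: jet v 0 0; jet v 0 1; jet v 0 2].

Definition lift_jet (w : 'rV[O]_3) : 'rV[O]_6 :=
  mkrow 6 [:: w 0 0; w 0 1; w 0 2;
              - (p3 S * w 0 1 + q3 S * w 0 2 + r3 S * w 0 0);
              - (p2 S * w 0 1 + q2 S * w 0 2 + r2 S * w 0 0);
              - (p1 S * w 0 1 + q1 S * w 0 2 + r1 S * w 0 0)].

Lemma lift_jetP w : lift_jet w \in R0_pred.
Proof.
apply/eqP/rowP; case=> [[|[|[|//]]] lt_k3]; rewrite !mxE /= ?mxE /=; ring.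
Qed.

Definition pi_inv (w : 'rV[O]_3) : R0 := MkR0 (lift_jetP w).

Lemma pi_invK : cancel pi_inv pi_.
Proof.
move=> w; apply/rowP; case=> [[|[|[|//]]] lt_k3]; rewrite !mxE /= ?mxE /=;
  by congr (w 0 _); apply/val_inj.
Qed.

Lemma pi_K : cancel pi_ pi_inv.
Proof.
move=> [v Rv]; apply: val_inj => /=.
have /eqP/rowP Sv := Rv.
have := Sv 0; have := Sv 1; have := Sv 2; rewrite !mxE /= => S2 S1 S0.
apply/rowP; case=> [[|[|[|[|[|[|//]]]]]] lt_k6]; rewrite !mxE /= ?mxE /=.
1-3: by congr (v 0 _); apply/val_inj.
all: symmetry; apply/eqP; rewrite -subr_eq0 opprK; apply/eqP.
- rewrite -[RHS]S0 !addrA; congr (v 0 _ + _ + _ + _); exact/val_inj.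
- rewrite -[RHS]S1 !addrA; congr (v 0 _ + _ + _ + _); exact/val_inj.
- rewrite -[RHS]S2 !addrA; congr (v 0 _ + _ + _ + _); exact/val_inj.
Qed.

Definition nabla0 (s : R0) : R0 * R0 :=
  (pi_inv (spencer s).1, pi_inv (spencer s).2).

(** ** Integrability conditions

  A row (c0, c1, c2) stands for the linear form
  c0 z + c1 z^(1,0) + c2 z^(0,1).  The rows [z20], [z11], [z02] are the second
  order derivatives expressed by the system, and [total_dx], [total_du]
  differentiate a linear form, replacing the second order derivatives of z
  that appear. *)

Definition z10 : 'rV[O]_3 := mkrow 3 [:: 0; 1; 0].
Definition z01 : 'rV[O]_3 := mkrow 3 [:: 0; 0; 1].
Definition z20 : 'rV[O]_3 := mkrow 3 [:: - r3 S; - p3 S; - q3 S].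
Definition z11 : 'rV[O]_3 := mkrow 3 [:: - r2 S; - p2 S; - q2 S].
Definition z02 : 'rV[O]_3 := mkrow 3 [:: - r1 S; - p1 S; - q1 S].

Definition total_dx (c : 'rV[O]_3) : 'rV[O]_3 :=
  map_mx (@dx K) c + (c 0 0 *: z10 + c 0 1 *: z20 + c 0 2 *: z11).
Definition total_du (c : 'rV[O]_3) : 'rV[O]_3 :=
  map_mx (@du K) c + (c 0 0 *: z01 + c 0 1 *: z11 + c 0 2 *: z02).

Definition integrability_conditions :=
  (forall k, (total_du z20 - total_dx z11) 0 k = 0) /\
  (forall k, (total_dx z02 - total_du z11) 0 k = 0).

End BundleOfSystem.
Arguments nabla0 {K} S s.

(** * Sheaves of functions on open subsets of K^2

  A section over W is represented by a function on K^2 of which only the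
  values on W matter. *)

Section Sheaves.
Variable K : numFieldType.

Definition fun_sheaf (V : Type) := set (K * K) -> set (K * K -> V).

Definition locally_constant (V : Type) : fun_sheaf V := fun W =>
  [set c | forall a, W a -> \forall b \near a, c b = c a].

(* Isomorphism of sheaves of K-vector spaces on the open set U.  The second
   clause says that phi is compatible with restrictions, and, for W' = W, that
   phi W f only depends on f on W. *)
Definition sheaf_isomorphic (V V' : lmodType K) (U : set (K * K))
    (F : fun_sheaf V) (G : fun_sheaf V') :=
  exists phi : set (K * K) -> (K * K -> V) -> (K * K -> V'),
  [/\ forall W, open W -> W `<=` U -> forall f, F W f -> G W (phi W f),
      forall W W', open W -> open W' -> W' `<=` W -> W `<=` U ->
        forall f g, F W f -> F W' g -> (forall a, W' a -> f a = g a) ->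
        forall a, W' a -> phi W f a = phi W' g a,
      forall W, open W -> W `<=` U -> forall k f g, F W f -> F W g ->
        forall a, W a ->
        phi W (fun y => k *: f y + g y) a = k *: phi W f a + phi W g a,
      forall W, open W -> W `<=` U -> forall f g, F W f -> F W g ->
        (forall a, W a -> phi W f a = phi W g a) ->
        forall a, W a -> f a = g a &
      forall W, open W -> W `<=` U -> forall g, G W g ->
        exists2 f, F W f & forall a, W a -> phi W f a = g a].

Definition local_system (V : lmodType K) n (U : set (K * K)) (F : fun_sheaf V) :=
  forall a, U a -> exists W : set (K * K), [/\ open W, W a, W `<=` U &
    sheaf_isomorphic W (@locally_constant 'rV[K]_n) F].

(* Representatives of the coefficients of the system: the germ of [F] at [a]
   is [S]. *)
Definition has_system_germ (F : system (K * K -> K)) (a : K * K)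
    (S : system (germ K)) :=
  [/\ has_germ (p1 F) a (p1 S), has_germ (p2 F) a (p2 S) & has_germ (p3 F) a (p3 S)] /\
  [/\ has_germ (q1 F) a (q1 S), has_germ (q2 F) a (q2 S) & has_germ (q3 F) a (q3 S)] /\
  [/\ has_germ (r1 F) a (r1 S), has_germ (r2 F) a (r2 S) & has_germ (r3 F) a (r3 S)].

(* The sheaf of horizontal sections of (R_0, nabla_0): its stalk at [a] is the
   kernel of nabla_0 for the germ of the system at [a]. *)
Definition horizontal_sheaf (F : system (K * K -> K)) : fun_sheaf 'rV[K]_6 :=
  fun W => [set s | forall a, W a -> exists S, has_system_germ F a S /\
    exists2 sigma : R0 S, horizontal (nabla0 S) sigma & has_germs s a sigma].

Definition solution_sheaf (F : system (K * K -> K)) : fun_sheaf K^o :=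
  fun W => [set z | forall a, W a -> exists S, has_system_germ F a S /\
    exists2 zeta : germ K, is_solution S zeta & has_germ z a zeta].

End Sheaves.

Definition CC (R : realType) : numFieldType := R[i].

(* Main.v *)
(* In the frame (z, p, q) of R_0 a section v is horizontal when dx v = v A and
  du v = v B, for matrices A and B read off the system, and the curvature is
  v |-> v (du A + B A - dx B - A B): its first column vanishes identically and
  the other two are the six integrability conditions.  When it vanishes, power
  series recursion (with geometric bounds) gives a matrix Phi, Phi(0) = 1, whose
  rows are horizontal; the dual system gives the inverse Psi of Phi.  For a
  horizontal v, dx (v Psi) = du (v Psi) = 0, so v is a constant combination of
  the rows of Phi.  Recentring power series at nearby points is a morphism that
  commutes with dx and du, so (Phi, Psi) is such a frame at every point near 0,
  and this trivialises the sheaf of horizontal sections; the first entry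
  identifies horizontal sections with solutions. *)
From HB Require Import structures.
Require Import Defs.
From mathcomp Require Import all_boot all_order all_algebra.
From mathcomp Require Import all_classical all_reals all_analysis.
From mathcomp Require Import complex ring zify.
Import Order.TTheory GRing.Theory Num.Theory numFieldNormedType.Exports.
Set Implicit Arguments.
Unset Strict Implicit.
Unset Printing Implicit Defensive.
Local Open Scope classical_set_scope.
Local Open Scope ring_scope.

(** The only analytic property of C that enters is convergence of sequences whose increments are
    bounded by a multiple of 2^-n. The sum of a power series is defined by square partial sums, so
    products and recentrings are justified by exact identities between finite square sums, up to an
    error of order 2^-n. Points are taken so small that the terms decay like 4^-(i+j): one factor
    2^-n pays for the number of terms in the border of a square, the other survives. Products start
    from the ratio 1/16, because a Cauchy coefficient has (i+1)(j+1) terms. Flatness is an identity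
    of germs at 0, whereas the sheaves live at all nearby points; hence Phi and Psi are moved there
    together with all their equations. Since a function has at most one germ at a point,
    compatibility of recentring with products and opposites follows by exhibiting one function that
    has both germs; only derivatives are compared coefficient by coefficient. *)

Definition geometrically_complete (K : numFieldType) :=
  forall (u : nat -> K) (C : K),
    (forall n, `|u n.+1 - u n| <= C * 2^-1 ^+ n) -> exists s : K, u @ \oo --> s.

(** * Completeness of C for geometric increments *)

Section CompleteComplex.
Variable R : realType.

Lemma real_geometrically_complete (u : nat -> R) (C : R) :
  (forall n, `|u n.+1 - u n| <= C * 2^-1 ^+ n) -> exists s : R, u @ \oo --> s.
Proof.
move=> uC; suff : cvgn (series (fun n => u n.+1 - u n)).
  move=> /(is_cvgD (is_cvg_cst (u 0%N))) /cvg_ex[s us]; exists s.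
  apply: cvg_trans us; apply: near_eq_cvg; near=> n => /=.
  change (u 0%N + series (fun k => u k.+1 - u k) n = u n).
  by rewrite /series /= telescope_sumr // addrC subrK.
apply: normed_cvg; apply: (@series_le_cvg _ _ (geometric C 2^-1)) => //.
- by move=> n /=; exact: normr_ge0.
- by move=> n /=; apply: le_trans (uC n).
- by apply: is_cvg_geometric_series; rewrite ger0_norm ?invr_ge0 // invf_lt1 ?ltr1n.
Unshelve. all: by end_near. Qed.

Lemma CC_geometrically_complete : geometrically_complete (CC R).
Proof.
move=> u C uC.
(* [C] dominates a norm, so it is nonnegative and therefore real; the bound then passes to real and
   imaginary parts. *)
have C0 : 0 <= C by have := uC 0%N; rewrite expr0 mulr1; exact: le_trans.
have [c Cc] : exists c : R, C = c%:C%C by exists (complex.Re C); rewrite RRe_real ?ger0_real //.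
have uCE n : C * 2^-1 ^+ n = (c * 2^-1 ^+ n)%:C%C.
  by rewrite rmorphM rmorphXn /= fmorphV rmorph_nat Cc.
have [n|x ux] := @real_geometrically_complete (fun n => complex.Re (u n)) c.
  rewrite -lecR -uCE.
  apply: le_trans (uC n); rewrite -raddfB /=; exact: normc_ge_Re.
have [n|y uy] := @real_geometrically_complete (fun n => complex.Im (u n)) c.
  rewrite -lecR -uCE.
  apply: le_trans (uC n); rewrite -raddfB /=; rewrite [leRHS]normc_def lecR.
  by rewrite -sqrtr_sqr ler_wsqrtr // lerDr sqr_ge0.
exists (x +i* y)%C; apply/cvgrPdist_lt => e e0.
have [d ed d0] : exists2 d : R, e = d%:C%C & 0 < d.
  have eE : e = (complex.Re e)%:C%C by rewrite RRe_real ?gtr0_real //.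
  by exists (complex.Re e) => //; rewrite -ltcR -eE.
move/cvgrPdist_lt/(_ (d / 2)) : ux; move/cvgrPdist_lt/(_ (d / 2)) : uy.
rewrite !divr_gt0 // => /(_ isT) uy /(_ isT) ux; near=> n.
have -> : (x +i* y)%C - u n =
    (x - complex.Re (u n))%:C%C + 'i%C * (y - complex.Im (u n))%:C%C.
  by case: (u n) => a b; rewrite [LHS]complexE.
have real_normc (t : R) : `|t%:C%C| = `|t|%:C%C :> R[i].
  by rewrite normc_def /= expr0n addr0 sqrtr_sqr.
have normci : `|'i%C| = 1 :> R[i] by rewrite normc_def /= expr0n expr1n add0r sqrtr1.
apply: le_lt_trans (ler_normD _ _) _; rewrite normrM normci mul1r.
rewrite !real_normc -rmorphD /= ed ltcR (splitr d) ltrD //; near: n; [exact: ux|exact: uy].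
Unshelve. all: by end_near. Qed.

End CompleteComplex.

(** * Square partial sums of double series *)

Section DoubleSums.
Variable K : numFieldType.
Implicit Types (b c : nat -> nat -> K) (C D : K).

Definition square_sum b n := \sum_(i < n) \sum_(j < n) b i j.

Definition dominated C (r : K) b := forall i j, `|b i j| <= C * r ^+ (i + j).

Lemma dominated_ge0 C r b : dominated C r b -> 0 <= C.
Proof. by move=> /(_ 0 0)%N; rewrite mulr1; exact: le_trans. Qed.

Lemma square_sumD b c n :
  square_sum (fun i j => b i j + c i j) n = square_sum b n + square_sum c n.
Proof. by rewrite -big_split; apply: eq_bigr => i _; rewrite -big_split. Qed.

Lemma square_sumM (k : K) b n :
  square_sum (fun i j => k * b i j) n = k * square_sum b n.
Proof. by rewrite mulr_sumr; apply: eq_bigr => i _; rewrite mulr_sumr. Qed.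

Lemma square_sumB b c n :
  square_sum (fun i j => b i j - c i j) n = square_sum b n - square_sum c n.
Proof.
rewrite square_sumD; congr (_ + _); rewrite -mulN1r -square_sumM.
by apply: eq_bigr => i _; apply: eq_bigr => j _; rewrite mulN1r.
Qed.

Lemma square_sum_swap b n : square_sum (fun i j => b j i) n = square_sum b n.
Proof. exact: exchange_big. Qed.

Lemma eq_square_sum b c n :
  (forall i j, (i < n)%N -> (j < n)%N -> b i j = c i j) ->
  square_sum b n = square_sum c n.
Proof. by move=> bc; apply: eq_bigr => i _; apply: eq_bigr => j _; exact: bc. Qed.

Lemma square_sumS b n : square_sum b n.+1 - square_sum b n =
  \sum_(j < n.+1) b n j + \sum_(i < n) b i n.
Proof.
rewrite /square_sum big_ord_recr /=.
under [X in X + _ - _]eq_bigr do rewrite big_ord_recr /=.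
by rewrite big_split /=; ring.
Qed.

(** The border added to the square has 2n+1 terms, each at most C 4^-n. One of the two factors of
    4^-n = 2^-n 2^-n absorbs their number, since 2n+1 <= 2 * 2^n. *)
Lemma square_sum_step C b n : dominated C 4^-1 b ->
  `|square_sum b n.+1 - square_sum b n| <= C * 2 * 2^-1 ^+ n.
Proof.
move=> bC; have C0 := dominated_ge0 bC.
rewrite square_sumS.
have q0 : 0 <= C * 4^-1 ^+ n by rewrite mulr_ge0 ?exprn_ge0 ?invr_ge0.
have le1 k : 4^-1 ^+ k <= 1 :> K by rewrite exprn_ile1 ?invr_ge0 // invf_le1 ?ler1n.
have bnd i j : (n <= i + j)%N -> `|b i j| <= C * 4^-1 ^+ n.
  move=> nij; apply: le_trans (bC i j) _; rewrite ler_wpM2l // -(subnK nij) exprD.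
  by rewrite ler_piMl ?exprn_ge0 ?invr_ge0.
apply: le_trans (_ : C * 4^-1 ^+ n * (n.+1 + n)%:R <= _).
  rewrite natrD mulrDr; apply: le_trans (ler_normD _ _) _; apply: lerD.
    apply: le_trans (ler_norm_sum _ _ _) _.
    rewrite -[n.+1 in leRHS]card_ord mulr_natr -sumr_const; apply: ler_sum => j _.
    by rewrite bnd ?leq_addr.
  apply: le_trans (ler_norm_sum _ _ _) _.
  rewrite -[n in X in _ <= _ * X]card_ord mulr_natr -sumr_const; apply: ler_sum => j _.
  by rewrite bnd ?leq_addl.
have -> : 4^-1 = 2^-1 * 2^-1 :> K by rewrite -invfM -natrM.
rewrite exprMn -!mulrA ler_wpM2l // [2 * _]mulrC ler_wpM2l ?exprn_ge0 ?invr_ge0 //.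
rewrite exprVn ler_pdivrMl ?exprn_gt0 // -natrX -natrM ler_nat.
have := ltn_expl n (isT : 1 < 2)%N; lia.
Qed.

Lemma square_sum_dist C b m n : dominated C 4^-1 b -> (n <= m)%N ->
  `|square_sum b m - square_sum b n| <= C * 4 * 2^-1 ^+ n.
Proof.
move=> bC /subnK <-; have C0 := dominated_ge0 bC.
(* A telescoping bound makes the induction on [k] close: C * 2 * 2^-m is exactly C * 4 * (2^-m -
   2^-(m+1)). *)
suff H k : `|square_sum b (k + n) - square_sum b n| <=
    C * 4 * (2^-1 ^+ n - 2^-1 ^+ (k + n)).
  apply: le_trans (H _) _; rewrite ler_wpM2l ?mulr_ge0 // gerBl.
  by rewrite exprn_ge0 ?invr_ge0.
elim: k => [|k IHk]; first by rewrite !subrr normr0 mulr0.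
rewrite addSn -(subrK (square_sum b (k + n)) (square_sum b _.+1)) -addrA.
apply: le_trans (ler_normD _ _) _.
apply: le_trans (lerD (square_sum_step (k + n) bC) IHk) _.
rewrite exprS; have : 2^-1 * 4 = 2 :> K by rewrite (natrM _ 2 2) mulKf.
move=> E; rewrite le_eqVlt; apply/orP; left; apply/eqP.
rewrite [RHS]mulrBr [_ * (2^-1 * _)]mulrA -[C * 4 * 2^-1]mulrA [4 * _]mulrC E.
have -> : 4 = 2 + 2 :> K by rewrite -natrD.
by ring.
Qed.

(* The coefficients beyond index n of the product of the truncations of b and
   c at n account for the whole difference. *)
Lemma square_sum_mul C D b c n : dominated C 16^-1 b -> dominated D 16^-1 c ->
  `|square_sum b n * square_sum c n - square_sum (Defs.cauchy b c) n|
    <= C * D * 4 * 2^-1 ^+ n.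
Proof.
move=> bC cD; have C0 := dominated_ge0 bC; have D0 := dominated_ge0 cD.
set P := trunc2 n b; set Q := trunc2 n c.
pose e i j := (P * Q)`_i`_j.
have trunc_dom X a : dominated X 16^-1 a ->
    dominated X 16^-1 (fun i j => (trunc2 n a)`_i`_j).
  move=> aX i j; have X0 := dominated_ge0 aX; have := aX i j.
  have X1 : 0 <= X * 16^-1 ^+ (i + j) by rewrite mulr_ge0 ?exprn_ge0 ?invr_ge0.
  rewrite coef_poly; case: ifP => _; last by rewrite coef0 normr0.
  by rewrite coef_poly; case: ifP => _ //; rewrite normr0.
(* The coefficient (i, j) is a sum of (i+1)(j+1) <= 4^(i+j) products, each at most C D 16^-(i+j). *)
have eCD : dominated (C * D) 4^-1 e.
  move=> i j; rewrite /e coef_mul2.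
  apply: le_trans (ler_norm_sum _ _ _) _.
  apply: le_trans (_ : \sum_(k < i.+1) \sum_(l < j.+1) C * D * 16^-1 ^+ (i + j) <= _).
    apply: ler_sum => k _; apply: le_trans (ler_norm_sum _ _ _) _.
    apply: ler_sum => l _.
    have -> : (i + j = (k + l) + ((i - k) + (j - l)))%N.
      have := ltn_ord k; have := ltn_ord l; lia.
    rewrite normrM exprD mulrACA.
    by apply: ler_pM => //; [exact: trunc_dom bC _ _|exact: trunc_dom cD _ _].
  rewrite !sumr_const !card_ord -mulrnA -[leLHS]mulr_natr -[leLHS]mulrA ler_wpM2l ?mulr_ge0 //.
  have -> : 16^-1 = 4^-1 * 4^-1 :> K by rewrite -invfM -natrM.
  rewrite exprMn -mulrA ler_piMr ?exprn_ge0 ?invr_ge0 //.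
  rewrite exprVn ler_pdivrMl ?exprn_gt0 // mulr1 -natrX ler_nat.
  rewrite mulnC expnD leq_mul //; exact: ltn_expl.
(* On a square containing all coefficients of the polynomial product, the square sum is the value at
   (1, 1), and evaluation is multiplicative. *)
have full : exists2 m, (n <= m)%N & square_sum e m = square_sum b n * square_sum c n.
  pose m := (n + size (P * Q)%R + \max_(i < size (P * Q)%R) size ((P * Q)`_i)%R)%N.
  have value (G : {poly {poly K}}) m' : (size G <= m')%N ->
      (forall i, (size (G`_i)%R <= m')%N) ->
      square_sum (fun i j => G`_i`_j) m' = G.[1].[1].
    move=> Gm Gim; rewrite (horner_coef_wide _ Gm) horner_sum; apply: eq_bigr => i _.
    rewrite expr1n mulr1 (horner_coef_wide _ (Gim i)).
    by apply: eq_bigr => j _; rewrite expr1n mulr1.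
  have truncv a : square_sum a n = (trunc2 n a).[1].[1].
    rewrite -(value _ n) ?size_poly //.
      by apply: eq_square_sum => i j lin ljn; rewrite coef_trunc2.
    move=> i; rewrite coef_poly; case: ifP => _; last by rewrite size_poly0.
    exact: size_poly.
  exists m; first by rewrite /m -addnA leq_addr.
  rewrite /e value; first by rewrite !truncv !hornerM.
    by rewrite /m -addnA addnCA leq_addr.
  move=> i; case: (ltnP i (size (P * Q))) => [lti|gei]; last first.
    by rewrite nth_default // size_poly0.
  rewrite /m (leq_trans _ (leq_addl _ _)) //.
  exact: (leq_bigmax (Ordinal lti)).
have [m nm <-] := full.
have -> : square_sum (Defs.cauchy b c) n = square_sum e n.
  by apply: eq_square_sum => i j lin ljn; rewrite (cauchyE b c lin ljn).
exact: square_sum_dist.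
Qed.

End DoubleSums.

(** * Functions with a given germ, and uniqueness of germs *)

Section Germs.
Variable K : numFieldType.
Implicit Types (b c : nat -> nat -> K) (g : germ K) (h a : K * K) (f : K * K -> K).

Lemma seq_cvg_unique (u : nat -> K) (s t : K) :
  u @ \oo --> s -> u @ \oo --> t -> s = t.
Proof. by apply: (cvg_unique (T := K)); exact: norm_hausdorff. Qed.

Lemma seq_cvgMl (k : K) (u : nat -> K) (s : K) :
  u @ \oo --> s -> (fun n => k * u n) @ \oo --> k * s.
Proof. by move=> us; apply: (cvgM (f := fun=> k)) us; exact: cvg_cst. Qed.

Lemma square_sum_lim_dist C b (s : K) n : dominated C 4^-1 b ->
  square_sum b @ \oo --> s -> `|s - square_sum b n| <= C * 4 * 2^-1 ^+ n.
Proof.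
move=> bC bs; apply/ler_addgt0Pr => e e0.
have /cvgrPdist_lt/(_ e e0)[m _ bm] := bs.
have := bm (maxn m n) (leq_maxl _ _) => /= dist.
rewrite -(subrK (square_sum b (maxn m n)) s) -addrA.
apply: le_trans (ler_normD _ _) _; rewrite [leRHS]addrC lerD ?(ltW dist) //.
by apply: square_sum_dist bC _; exact: leq_maxr.
Qed.

Lemma square_sum_lim_le C b (s : K) : dominated C 4^-1 b ->
  square_sum b @ \oo --> s -> `|s| <= C * 4.
Proof.
move=> bC /(square_sum_lim_dist 0 bC).
by rewrite /square_sum big_ord0 subr0 mulr1.
Qed.

(** Closed polydiscs keep the later estimates non-strict; halving the radius of a ball provides
    one. *)
Lemma near0P (P : K * K -> Prop) : (\forall h \near (0 : K * K), P h) <->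
  exists2 d : K, 0 < d & forall h, `|h.1| <= d -> `|h.2| <= d -> P h.
Proof.
split=> [/nbhs_ballP[d /= d0 dP]|[d d0 dP]]; last first.
  apply/nbhs_ballP; exists d => // h [/= h1 h2]; apply: dP; apply: ltW.
    by move: h1; rewrite -ball_normE /= sub0r normrN.
  by move: h2; rewrite -ball_normE /= sub0r normrN.
exists (d / 2) => [|h h1 h2]; first by rewrite divr_gt0.
have d2 : d / 2 < d by rewrite ltr_pdivrMr // ltr_pMr // ltr1n.
by apply: dP; split; rewrite -ball_normE /= sub0r normrN (le_lt_trans _ d2).
Qed.

(** With this, [has_germ f a g] converts to convergence of [square_sum (term g h)] to [f (a + h)]
    for small [h]. *)
Definition term c h i j := c i j * h.1 ^+ i * h.2 ^+ j.

Lemma term_dominated (M L r : K) c h : 0 <= L -> dominated M L c ->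
  L * `|h.1| <= r -> L * `|h.2| <= r -> dominated M r (term c h).
Proof.
move=> L0 gML h1 h2 i j; rewrite /term !normrM !normrX.
have M0 : 0 <= M by have := gML 0%N 0%N; rewrite mulr1; exact: le_trans.
apply: le_trans (_ : M * L ^+ (i + j) * `|h.1| ^+ i * `|h.2| ^+ j <= _).
  by rewrite !ler_wpM2r ?exprn_ge0.
have -> : M * L ^+ (i + j) * `|h.1| ^+ i * `|h.2| ^+ j =
    M * ((L * `|h.1|) ^+ i * (L * `|h.2|) ^+ j).
  by rewrite !exprMn exprD; ring.
rewrite ler_wpM2l // exprD ler_pM ?exprn_ge0 ?mulr_ge0 //; apply: lerXn2r => //;
  by rewrite ?nnegrE ?mulr_ge0 // (le_trans _ h1) ?mulr_ge0.
Qed.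

(** [M] is fixed before [r]: restricting [h] to |h| <= r / L changes only the ratio, so 1/4 and 1/16
    are both available. *)
Lemma near_term_dominated g :
  exists M : K, forall r, 0 < r -> \forall h \near (0 : K * K), dominated M r (term g h).
Proof.
have [M [L [M0 L1 gML]]] := convergentP (coefs_convergent g).
have L0 : 0 < L by exact: lt_le_trans L1.
exists M => r r0; apply/near0P; exists (r / L) => [|h h1 h2]; first exact: divr_gt0.
by apply: term_dominated gML _ _; rewrite ?(ltW L0) // mulrC -ler_pdivlMr.
Qed.

Lemma has_germ_near_eq f f' a g : has_germ f a g -> has_germ f' a g ->
  \forall h \near (0 : K * K), f (a + h) = f' (a + h).
Proof.
move=> fg f'g; near=> h; apply: (@seq_cvg_unique (square_sum (term g h))).
- by near: h.
- by near: h.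
Unshelve. all: by end_near. Qed.

Lemma term0 g n : square_sum (term g 0) n.+1 = g 0%N 0%N.
Proof.
rewrite /square_sum big_ord_recl [X in _ + X]big1 ?addr0.
  rewrite big_ord_recl [X in _ + X]big1 ?addr0 => [|j _]; last by rewrite /term exprS mul0r mulr0.
  by rewrite /term !expr0 !mulr1.
by move=> i _; rewrite big1 // => j _; rewrite /term exprS mul0r mulr0 mul0r.
Qed.

Lemma has_germ_center f a g : has_germ f a g -> f a = g 0%N 0%N.
Proof.
move=> fg; have := nbhs_singleton fg; rewrite addr0.
move=> fa; apply: (seq_cvg_unique fa); rewrite -(cvg_shiftS (square_sum (term g 0))).
by under eq_fun do rewrite term0; exact: cvg_cst.
Qed.

Lemma has_germ_near f f' a g : (\forall h \near (0 : K * K), f (a + h) = f' (a + h)) ->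
  has_germ f a g -> has_germ f' a g.
Proof.
move=> ff' fg; near=> h; have <- : f (a + h) = f' (a + h) by near: h.
by near: h.
Unshelve. all: by end_near. Qed.

Lemma has_germ_cst (k : K) a : has_germ (fun=> k) a (cst_germ k).
Proof.
near=> h; rewrite -(cvg_shiftS (square_sum (term (cst_germ k) h))).
suff -> : [sequence square_sum (term (cst_germ k) h) n.+1]_n = (fun=> k) by exact: cvg_cst.
apply/funext => n; rewrite /= /square_sum big_ord_recl [X in _ + X]big1 ?addr0 => [|i _]; last first.
  by rewrite big1 // => j _; rewrite /term /= !mul0r.
rewrite big_ord_recl [X in _ + X]big1 ?addr0 => [|i _]; last by rewrite /term /= !mul0r.
by rewrite /term /= !mulr1.
Unshelve. all: by end_near. Qed.

Lemma has_germD f f' a g g' : has_germ f a g -> has_germ f' a g' ->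
  has_germ (fun y => f y + f' y) a (g + g').
Proof.
move=> fg f'g'; near=> h.
have -> : (fun n => square_sum (term (g + g') h) n) =
    (fun n => square_sum (term g h) n + square_sum (term g' h) n).
  apply/funext => n; rewrite -square_sumD; apply: eq_square_sum => i j _ _.
  by rewrite /term /= !mulrDl.
by apply: cvgD; near: h.
Unshelve. all: by end_near. Qed.

Lemma has_germZ (k : K) f a g : has_germ f a g ->
  has_germ (fun y => k * f y) a (k *: g).
Proof.
move=> fg; near=> h.
have -> : (fun n => square_sum (term (k *: g) h) n) =
    (fun n => k * square_sum (term g h) n).
  apply/funext => n; rewrite -square_sumM; apply: eq_square_sum => i j _ _.
  by rewrite /term /= !mulrA.
by apply: seq_cvgMl; near: h.
Unshelve. all: by end_near. Qed.

Lemma square_sum_delta (v : K) i0 j0 n : (i0 < n)%N -> (j0 < n)%N ->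
  square_sum (fun i j => if (i == i0) && (j == j0) then v else 0) n = v.
Proof.
move=> i0n j0n; rewrite /square_sum (bigD1 (Ordinal i0n)) //=.
rewrite [X in _ + X]big1 ?addr0; last first.
  move=> k /negPf ki0; rewrite big1 // => l _.
  by rewrite -(inj_eq val_inj) /= in ki0; rewrite ki0.
rewrite (bigD1 (Ordinal j0n)) //= !eqxx [X in _ + X]big1 ?addr0 //.
by move=> l /negPf lj0; rewrite -(inj_eq val_inj) /= in lj0; rewrite lj0.
Qed.

(* If d = g - g' had a nonzero coefficient, let (i0, j0) index the
   lexicographically first one: along h = (t^(j0 + 1), t) it dominates as t -> 0. *)
Lemma germ_unique f a g g' : has_germ f a g -> has_germ f a g' -> g = g'.
Proof.
move=> fg fg'; pose d : germ K := g - g'.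
have d0 : has_germ (fun=> 0) a d.
  have := has_germD fg (has_germZ (-1) fg'); rewrite scaleN1r.
  by apply: has_germ_near; near=> h; rewrite mulN1r subrr.
suff dz i j : d i j = 0.
  by apply: germ_eq => k l; apply/eqP; rewrite -subr_eq0; apply/eqP; exact: dz.
have [M [L [M0 L1 dML]]] := convergentP (coefs_convergent d).
have L0 : 0 < L by exact: lt_le_trans L1.
have /near0P[e e0 de] := d0.
apply: contrapT => /eqP dij.
have exi : exists k, `[< exists l, d k l != 0 >] by exists i; apply/asboolP; exists j.
case: (ex_minnP exi) => i0 /asboolP exj min_i.
case: (ex_minnP exj) => j0 dij0 min_j.
(* Each summand serves one bound: t <= e stays where [d] sums to 0, L t <= 1/4 gives domination, and
   t <= 1 bounds t^(N k + l) by t^(k + l). *)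
pose t := (e^-1 + 4 * L + 1)^-1.
have pos : 0 < e^-1 + 4 * L + 1 by rewrite !addr_gt0 ?mulr_gt0 ?invr_gt0.
have t0 : 0 < t by rewrite invr_gt0.
have te : t <= e.
  rewrite -[e]invrK lef_pV2 ?posrE ?invr_gt0 // -addrA lerDl addr_ge0 ?mulr_ge0 ?(ltW L0) //.
have tL : L * t <= 4^-1.
  rewrite ler_pdivrMr // mulrDr mulrDr mulrA mulVf ?pnatr_eq0 // mul1r mulr1.
  by rewrite -addrA addrCA lerDl addr_ge0 ?mulr_ge0 ?invr_ge0 // ltW.
have t1 : t <= 1.
  by rewrite invf_le1 // lerDr addr_ge0 ?invr_ge0 ?mulr_ge0 ?(ltW e0) ?(ltW L0).
(* The term (k, l) has degree N k + l along the curve. Every index lexicographically after (i0, j0)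
   gets a degree above E, because raising k by one gains N > j0. *)
pose N := j0.+1; pose E := (N * i0 + j0)%N.
pose b (x : K) i j := term d ((t * x) ^+ N, t * x) i j -
  (if (i == i0) && (j == j0) then d i0 j0 * (t * x) ^+ E else 0).
have termE x k l : term d ((t * x) ^+ N, t * x) k l = d k l * (t * x) ^+ (N * k + l).
  by rewrite /term /= -mulrA -exprM exprD.
have bdom (x : K) : 0 < x -> x <= 1 -> dominated (M * x ^+ E.+1) 4^-1 (b x).
  move=> x0 x1 k l; have bnd0 : 0 <= M * x ^+ E.+1 * 4^-1 ^+ (k + l).
    by rewrite !mulr_ge0 ?exprn_ge0 ?invr_ge0 // ltW.
  rewrite /b termE; case: ifP => [/andP[/eqP ki /eqP lj]|kl].
    by rewrite ki lj subrr normr0 -ki -lj.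
  rewrite subr0; have [->|dkl] := eqVneq (d k l) 0; first by rewrite mul0r normr0.
  have i0k : (i0 <= k)%N by apply: min_i; apply/asboolP; exists l.
  have Ekl : (E < N * k + l)%N.
    move: i0k; rewrite leq_eqVlt => /orP[/eqP i0k|i0k].
      rewrite -i0k in dkl kl *; rewrite ltn_add2l ltn_neqAle min_j // andbT.
      by apply/eqP => j0l; rewrite j0l !eqxx in kl.
    apply: leq_trans (leq_addr _ _);     by apply: leq_trans (leq_mul (leqnn N) i0k); rewrite mulnS /E [leqRHS]addnC ltn_add2l.
  rewrite normrM normrX (ger0_norm (mulr_ge0 (ltW t0) (ltW x0))) exprMn.
  apply: le_trans (_ : M * L ^+ (k + l) * (t ^+ (k + l) * x ^+ E.+1) <= _).
    apply: ler_pM => //; first by rewrite mulr_ge0 ?exprn_ge0 ?(ltW t0) ?(ltW x0).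
    apply: ler_pM; rewrite ?exprn_ge0 ?(ltW t0) ?(ltW x0) //.
      by apply: ler_wiXn2l; rewrite ?(ltW t0) // leq_add2r leq_pmull.
    by apply: ler_wiXn2l; rewrite ?(ltW x0).
  rewrite -mulrA [L ^+ _ * _]mulrA -exprMn [_ * x ^+ _]mulrC mulrA ler_wpM2l //.
    by rewrite mulr_ge0 // exprn_ge0 // ltW.
  by apply: lerXn2r => //; rewrite nnegrE ?invr_ge0 // mulr_ge0 // ltW.
(* The whole sum is 0, so the leading term is minus the sum of the others, which is O(x^(E+1));
   dividing by x^E leaves a bound linear in [x]. *)
have small (x : K) : 0 < x -> x <= 1 -> `|d i0 j0| * t ^+ E <= M * 4 * x.
  move=> x0 x1; have tx0 : 0 < t * x by rewrite mulr_gt0.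
  have txt : t * x <= t by rewrite ler_piMr // ltW.
  have bl : square_sum (b x) @ \oo --> - (d i0 j0 * (t * x) ^+ E).
    rewrite -[X in _ --> X]add0r.
    have := de ((t * x) ^+ N, t * x); rewrite /= normrX (ger0_norm (ltW tx0)).
    have txe : t * x <= e by exact: le_trans te.
    have txNe : (t * x) ^+ N <= e.
      by apply: le_trans txe; rewrite exprS ler_piMr ?(ltW tx0) // exprn_ile1 ?(ltW tx0) // (le_trans txt).
    move=> /(_ txNe txe) tl.
    apply: cvg_trans (cvgB tl (cvg_cst (d i0 j0 * (t * x) ^+ E))).
    apply: near_eq_cvg; near=> n.
    have i0n : (i0 < n)%N by near: n; exact: nbhs_infty_gt.
    have j0n : (j0 < n)%N by near: n; exact: nbhs_infty_gt.
    rewrite /b square_sumB; congr (_ - _).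
    by rewrite square_sum_delta.
  have := square_sum_lim_le (bdom x x0 x1) bl.
  rewrite normrN normrM normrX (ger0_norm (ltW tx0)) exprMn mulrA exprS.
  have -> : M * (x * x ^+ E) * 4 = M * 4 * x * x ^+ E by ring.
  by rewrite ler_pM2r ?exprn_gt0.
have c0 : 0 < `|d i0 j0| * t ^+ E by rewrite mulr_gt0 ?normr_gt0 ?exprn_gt0.
set c := `|d i0 j0| * t ^+ E in c0 small.
have p0 : 0 < M * 4 + c by rewrite ltr_wpDl // mulr_ge0.
(* At this [x] the bound would give M * 4 + c <= M * 4, against c > 0. *)
have := small (c / (M * 4 + c)); rewrite divr_gt0 // ler_pdivrMr // mul1r lerDr mulr_ge0 //.
move=> /(_ isT isT); rewrite mulrA ler_pdivlMr // [c * _]mulrC ler_pM2r //.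
by rewrite gerDl lt_geF.
Unshelve. all: by end_near. Qed.

End Germs.

(** * Products and recentring of convergent series *)

Section CompleteGerms.
Variable K : numFieldType.
Hypothesis Kcomplete : geometrically_complete K.
Implicit Types (b c : nat -> nat -> K) (g : germ K) (h a : K * K) (f : K * K -> K).

(** [K] is not assumed archimedean, so this too comes from completeness: the increments are
    geometric, hence a limit s exists, and shifting the sequence gives s / 2 = s. *)
Lemma half_exp_cvg0 : (fun n => 2^-1 ^+ n : K) @ \oo --> (0 : K).
Proof.
have half : 2^-1 - 1 = - 2^-1 :> K.
  by rewrite -[X in _ - X](mulVf (_ : 2 != 0 :> K)) ?pnatr_eq0 //; ring.
have [n|s us] := Kcomplete (u := fun n => 2^-1 ^+ n) (C := 2^-1).
  rewrite exprS -{2}[2^-1 ^+ n]mul1r -mulrBl half normrM normrN.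
  by rewrite !ger0_norm ?exprn_ge0 ?invr_ge0.
have us' := @seq_cvgMl K 2^-1 _ _ us.
suff s0 : s = 0 by rewrite s0 in us.
have ss : 2^-1 * s = s.
  apply: (seq_cvg_unique us'); rewrite -(cvg_shiftS (fun n => 2^-1 ^+ n : K)) in us.
  by under eq_fun do rewrite -exprS.
have : (2^-1 - 1) * s = 0 by rewrite mulrBl ss mul1r subrr.
by move=> /eqP; rewrite half mulf_eq0 oppr_eq0 invr_eq0 pnatr_eq0 /= => /eqP.
Qed.

Lemma cvg_half_dist (u v : nat -> K) (C s : K) :
  (forall n, `|u n - v n| <= C * 2^-1 ^+ n) -> v @ \oo --> s -> u @ \oo --> s.
Proof.
move=> uv /cvgrPdist_lt vs; apply/cvgrPdist_lt => e e0.
have /cvgrPdist_lt/(_ (e / 2)) := @seq_cvgMl K C _ _ half_exp_cvg0.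
have /(_ (e / 2)) := vs; rewrite !divr_gt0 // => /(_ isT) vs' /(_ isT) small.
near=> n; rewrite -(subrK (v n) s) -addrA (le_lt_trans (ler_normD _ _)) // (splitr e).
apply: ltrD; first by near: n.
rewrite distrC (le_lt_trans (uv n)) //.
have C0 : 0 <= C * 2^-1 ^+ n by exact: le_trans (uv n).
suff : `|C * 0 - C * 2^-1 ^+ n| < e / 2 by rewrite mulr0 sub0r normrN ger0_norm.
by near: n.
Unshelve. all: by end_near. Qed.

Lemma square_sum_cvg C b : dominated C 4^-1 b -> exists s : K, square_sum b @ \oo --> s.
Proof.
by move=> bC; apply: (Kcomplete (C := C * 2)) => n; exact: square_sum_step.
Qed.

Lemma has_germM f f' a g g' : has_germ f a g -> has_germ f' a g' ->
  has_germ (fun y => f y * f' y) a (g * g').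
Proof.
move=> fg f'g'; have [M gM] := near_term_dominated g.
have [M' g'M] := near_term_dominated g'.
near=> h; have fh : square_sum (term g h) @ \oo --> f (a + h) by near: h.
have fh' : square_sum (term g' h) @ \oo --> f' (a + h) by near: h.
have bh : dominated M 16^-1 (term g h).
  by near: h; apply: gM; rewrite invr_gt0.
have bh' : dominated M' 16^-1 (term g' h).
  by near: h; apply: g'M; rewrite invr_gt0.
apply: (cvg_half_dist (C := M * M' * 4) _ (cvgM fh fh')) => n.
rewrite distrC; apply: le_trans (square_sum_mul n bh bh').
rewrite le_eqVlt; apply/orP; left; apply/eqP; congr (`|_ - _|).
(* Since h^i = h^k h^(i-k), the terms of the product series are the Cauchy product of the terms of
   the factors. *)
apply: (@eq_square_sum _ (term (g * g') h)) => i j _ _.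
rewrite {1}/term /= /Defs.cauchy mulr_suml mulr_suml; apply: eq_bigr => k _.
rewrite mulr_suml mulr_suml; apply: eq_bigr => l _; rewrite /term.
have -> : h.1 ^+ i = h.1 ^+ k * h.1 ^+ (i - k).
  by rewrite -exprD subnKC // -ltnS ltn_ord.
have -> : h.2 ^+ j = h.2 ^+ l * h.2 ^+ (j - l).
  by rewrite -exprD subnKC // -ltnS ltn_ord.
by ring.
Unshelve. all: by end_near. Qed.

(* The terms of the series, obtained by expanding (h + k)^(i, j), whose sum is
   the coefficient of k^(m, l) in the recentred series. *)
Definition recentre_term h g m l i j : K :=
  g i j * ('C(i, m)%:R * h.1 ^+ (i - m)) * ('C(j, l)%:R * h.2 ^+ (j - l)).

Definition recentre_coef h g m l : K :=
  xget 0 [set s | square_sum (recentre_term h g m l) @ \oo --> s].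

(** A germ carries its convergence proof, which is guaranteed only for small [h]; the value 0 is a
    placeholder that [near_recentreE] excludes near the origin. *)
Definition recentre h g : germ K :=
  if pselect (convergent (recentre_coef h g)) is left cv then Germ cv else 0.

(** From C(i, m) <= 2^i and |t|^(i-m) <= D^m D^-i. The bound separates the indices: D^m becomes the
    growth of the recentred coefficients, (2 / D)^i the decay of the sum defining them. *)
Lemma binomial_power_le (t D : K) i m : 0 < D -> `|t| <= D^-1 ->
  `|'C(i, m)%:R * t ^+ (i - m)| <= D ^+ m * (2 * D^-1) ^+ i.
Proof.
move=> D0 tD; have [im|mi] := ltnP i m.
  by rewrite bin_small // mul0r normr0 !mulr_ge0 ?exprn_ge0 ?mulr_ge0 ?invr_ge0 ?(ltW D0).
rewrite normrM normr_nat normrX exprMn.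
apply: le_trans (_ : 2 ^+ i * (D^-1) ^+ (i - m) <= _).
  apply: ler_pM => //; rewrite ?exprn_ge0 //.
    rewrite -natrX ler_nat; apply: (@leq_trans (\sum_(k < i.+1) 'C(i, k))).
      by rewrite (bigD1 (Ordinal (mi : m < i.+1)%N)) //= leq_addr.
    by rewrite (Pascal 1 1 i) //; under [leqRHS]eq_bigr do rewrite !exp1n !muln1.
  by apply: lerXn2r; rewrite ?nnegrE ?invr_ge0 ?(ltW D0).
rewrite mulrCA ler_wpM2l ?exprn_ge0 //.
by rewrite -{2}(subnKC mi) exprD mulrA -exprMn mulfV ?gt_eqF // expr1n mul1r.
Qed.

(** The condition 8 L <= D is what brings the ratio L * 2 / D down to 1/4. *)
Lemma recentre_term_dominated (M L D : K) g h m l : 1 <= L -> 0 < D -> 8 * L <= D ->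
  (forall i j, `|g i j| <= M * L ^+ (i + j)) ->
  `|h.1| <= D^-1 -> `|h.2| <= D^-1 ->
  dominated (M * D ^+ (m + l)) 4^-1 (recentre_term h g m l).
Proof.
move=> L1 D0 LD gML h1 h2 i j; have L0 : 0 <= L by exact: le_trans L1.
have M0 : 0 <= M by have := gML 0%N 0%N; rewrite mulr1; exact: le_trans.
rewrite /recentre_term 2!normrM.
have D20 : 0 <= 2 * D^-1 by rewrite mulr_ge0 // invr_ge0 ltW.
apply: le_trans (_ : M * L ^+ (i + j) * (D ^+ m * (2 * D^-1) ^+ i) *
   (D ^+ l * (2 * D^-1) ^+ j) <= _).
  apply: ler_pM; rewrite ?mulr_ge0 //; last exact: binomial_power_le.
  by apply: ler_pM => //; exact: binomial_power_le.
have -> : M * L ^+ (i + j) * (D ^+ m * (2 * D^-1) ^+ i) * (D ^+ l * (2 * D^-1) ^+ j) =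
    M * D ^+ (m + l) * (L * (2 * D^-1)) ^+ (i + j).
  by rewrite !exprMn !exprD; ring.
rewrite ler_wpM2l ?mulr_ge0 ?exprn_ge0 ?(ltW D0) //.
apply: lerXn2r; rewrite ?nnegrE ?mulr_ge0 ?invr_ge0 //.
  by rewrite (ltW D0).
rewrite mulrA ler_pdivrMr // ler_pdivlMl //.
by have -> : 4 * (L * 2) = 8 * L by ring.
Qed.

Lemma recentre_coef_cvg C h g m l : dominated C 4^-1 (recentre_term h g m l) ->
  square_sum (recentre_term h g m l) @ \oo --> recentre_coef h g m l.
Proof.
move=> dom; exact: (@xgetPex _ 0
  [set s : K | square_sum (recentre_term h g m l) @ \oo --> s] (square_sum_cvg dom)).
Qed.

(** One neighbourhood of [h] serves all (m, l), and the constants grow geometrically in m + l; this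
    uniformity makes the recentred series converge. *)
Lemma near_recentre_dominated g : exists M D : K, 0 < D /\
  \forall h \near (0 : K * K), forall m l,
    dominated (M * D ^+ (m + l)) 4^-1 (recentre_term h g m l).
Proof.
have [M [L [M0 L1 gML]]] := convergentP (coefs_convergent g).
have D0 : 0 < 8 * L by rewrite mulr_gt0 // (lt_le_trans _ L1).
exists M, (8 * L); split => //; apply/near0P; exists (8 * L)^-1; first by rewrite invr_gt0.
by move=> h h1 h2 m l; exact: recentre_term_dominated gML h1 h2.
Qed.

Lemma near_recentreE g : \forall h \near (0 : K * K),
  forall m l, recentre h g m l = recentre_coef h g m l.
Proof.
have [M [D [D0 dom]]] := near_recentre_dominated g; near=> h => m l.
rewrite /recentre; case: pselect => // -[]; exists (M * 4), D => m' l'.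
have hdom : forall m l, dominated (M * D ^+ (m + l)) 4^-1 (recentre_term h g m l).
  by near: h.
by rewrite mulrAC; exact: square_sum_lim_le (recentre_coef_cvg (hdom _ _)).
Unshelve. all: by end_near. Qed.

(** The binomial theorem on finite sums. Cutting m and l at n loses nothing, since C(i, m) = 0 for m
    > i, so no infinite series is rearranged. *)
Lemma square_sum_recentre g h k n :
  square_sum (fun m l => square_sum (recentre_term h g m l) n * k.1 ^+ m * k.2 ^+ l) n =
  square_sum (term g (h + k)) n.
Proof.
have expand (x y : K) (i : 'I_n) :
    (x + y) ^+ i = \sum_(m < n) 'C(i, m)%:R * x ^+ (i - m) * y ^+ m.
  rewrite exprDn (big_ord_widen n (fun m => (x ^+ (i - m) * y ^+ m) *+ 'C(i, m))) //.
  rewrite big_mkcond; apply: eq_bigr => m _; rewrite ltnS; case: leqP => im.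
    by rewrite -mulr_natl mulrA.
  by rewrite bin_small // !mul0r.
rewrite /square_sum.
transitivity (\sum_(m < n) \sum_(i < n) \sum_(l < n) \sum_(j < n)
    recentre_term h g m l i j * k.1 ^+ m * k.2 ^+ l).
  apply: eq_bigr => m _; rewrite exchange_big; apply: eq_bigr => l _.
  rewrite mulr_suml mulr_suml; apply: eq_bigr => i _.
  by rewrite mulr_suml mulr_suml; apply: eq_bigr => j _.
rewrite exchange_big; apply: eq_bigr => i _.
under eq_bigr do rewrite exchange_big.
rewrite exchange_big; apply: eq_bigr => j _.
rewrite /term /= !expand -mulrA big_distrlr /= mulr_sumr; apply: eq_bigr => m _.
rewrite mulr_sumr; apply: eq_bigr => l _; rewrite /recentre_term; ring.
Qed.

Lemma has_germ_recentre f a g : has_germ f a g ->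
  \forall h \near (0 : K * K), has_germ f (a + h) (recentre h g).
Proof.
move=> /near0P[e e0 fg].
have [M [D [D0 dom]]] := near_recentre_dominated g.
near=> h; have he1 : `|h.1| <= e / 2.
  near: h; apply/near0P; exists (e / 2) => //; exact: divr_gt0.
have he2 : `|h.2| <= e / 2.
  near: h; apply/near0P; exists (e / 2) => //; exact: divr_gt0.
have hE : forall m l, recentre h g m l = recentre_coef h g m l.
  by near: h; exact: near_recentreE.
have hdom : forall m l, dominated (M * D ^+ (m + l)) 4^-1 (recentre_term h g m l).
  by near: h.
have M0 : 0 <= M by have := dominated_ge0 (hdom 0%N 0%N); rewrite mulr1.
near=> k; have ke1 : `|k.1| <= e / 2.
  near: k; apply/near0P; exists (e / 2) => //; exact: divr_gt0.
have ke2 : `|k.2| <= e / 2.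
  near: k; apply/near0P; exists (e / 2) => //; exact: divr_gt0.
have kD1 : D * `|k.1| <= 4^-1.
  near: k; apply/near0P; exists (4^-1 / D) => [|k k1 _].
    by rewrite divr_gt0 // invr_gt0.
  by rewrite mulrC -ler_pdivlMr.
have kD2 : D * `|k.2| <= 4^-1.
  near: k; apply/near0P; exists (4^-1 / D) => [|k _ k2].
    by rewrite divr_gt0 // invr_gt0.
  by rewrite mulrC -ler_pdivlMr.
have fhk : square_sum (term g (h + k)) @ \oo --> f (a + h + k).
  rewrite -addrA; apply: fg; rewrite /= (splitr e);
  by apply: le_trans (ler_normD _ _) _; exact: lerD.
apply: (cvg_half_dist (C := M * 4 * 4) _ fhk) => n.
rewrite -square_sum_recentre -[X in `|X - _|]/(square_sum (term (recentre h g) k) n).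
rewrite -square_sumB.
(* The tail of each recentred coefficient is at most 4 M D^(m+l) 2^-n; because D |k| <= 1/4, summing
   over (m, l) preserves the factor 2^-n. *)
pose c m l := recentre_coef h g m l - square_sum (recentre_term h g m l) n.
rewrite (@eq_square_sum _ _ (term c k)) => [|m l _ _]; last first.
  by rewrite /term /c hE -!mulrBl.
have cdom : dominated (M * 4 * 2^-1 ^+ n) D c.
  move=> m l; have := square_sum_lim_dist n (hdom m l) (recentre_coef_cvg (hdom m l)).
  by congr (_ <= _); ring.
have := square_sum_dist (term_dominated (ltW D0) cdom kD1 kD2) (leq0n n).
rewrite [X in _ - X]/square_sum big_ord0 subr0 expr0 mulr1 => /le_trans; apply.
by rewrite mulrAC.
Unshelve. all: by end_near. Qed.

End CompleteGerms.

Lemma filter_forall2 (T : Type) (I J : finType) (P : I -> J -> set T)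
    (F : set_system T) (FF : Filter F) :
  (forall i j, \forall x \near F, P i j x) -> \forall x \near F, forall i j, P i j x.
Proof.
move=> FP; apply: (@filter_forall T I (fun i x => forall j, P i j x)) => i.
exact: (@filter_forall T J (P i)).
Qed.

(** * Recentring commutes with derivatives and matrix products *)

Section RecentringMorphism.
Variable K : numFieldType.
Hypothesis Kcomplete : geometrically_complete K.
Implicit Types (b c : nat -> nat -> K) (g : germ K) (h a : K * K) (f : K * K -> K).

(** Differentiation shifts an index. As the row 0 vanishes, the shifted square differs from the
    original by the row n alone: n terms of size at most C 4^-n. *)
Lemma square_sum_shift C b (s : K) : dominated C 4^-1 b -> (forall j, b 0%N j = 0) ->
  square_sum b @ \oo --> s -> square_sum (fun i j => b i.+1 j) @ \oo --> s.
Proof.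
move=> bC b0 bs; have C0 := dominated_ge0 bC.
apply: (cvg_half_dist Kcomplete (C := C) _ bs) => n.
have -> : square_sum (fun i j => b i.+1 j) n - square_sum b n = \sum_(j < n) b n j.
  have : \sum_(i < n.+1) \sum_(j < n) b i j = \sum_(i < n.+1) \sum_(j < n) b i j by [].
  rewrite {1}big_ord_recl big_ord_recr /= big1 ?add0r => [|j _]; last exact: b0.
  rewrite /square_sum => ->; ring.
apply: le_trans (ler_norm_sum _ _ _) _.
apply: le_trans (_ : \sum_(j < n) C * 4^-1 ^+ n <= _).
  apply: ler_sum => j _; apply: le_trans (bC _ _) _; rewrite ler_wpM2l //.
  rewrite exprD ler_piMr ?exprn_ge0 ?invr_ge0 // exprn_ile1 ?invr_ge0 //.
  by rewrite invf_le1 ?ler1n.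
have -> : 4^-1 = 2^-1 * 2^-1 :> K by rewrite -invfM -natrM.
rewrite sumr_const card_ord -[leLHS]mulr_natr -mulrA ler_wpM2l // exprMn -mulrA.
rewrite ler_piMr ?exprn_ge0 ?invr_ge0 // exprVn ler_pdivrMl ?exprn_gt0 // mulr1.
by rewrite -natrX ler_nat ltnW // ltn_expl.
Qed.

Lemma near_recentre_dx g :
  \forall h \near (0 : K * K), recentre h (dx g) = dx (recentre h g).
Proof.
have [M [D [D0 dom]]] := near_recentre_dominated g.
have [M' [D' [D0' dom']]] := near_recentre_dominated (dx g).
near=> h; have gE : forall m l, recentre h g m l = recentre_coef h g m l.
  by near: h; exact: near_recentreE.
have dgE : forall m l, recentre h (dx g) m l = recentre_coef h (dx g) m l.
  by near: h; exact: near_recentreE.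
have hdom : forall m l, dominated (M * D ^+ (m + l)) 4^-1 (recentre_term h g m l).
  by near: h.
have hdom' : forall m l,
    dominated (M' * D' ^+ (m + l)) 4^-1 (recentre_term h (dx g) m l).
  by near: h.
apply: germ_eq => m l; rewrite /= gE dgE.
apply: (seq_cvg_unique (recentre_coef_cvg Kcomplete (hdom' m l))).
have b0 j : recentre_term h g m.+1 l 0 j = 0.
  by rewrite /recentre_term bin0n mul0r mulr0 mul0r.
have shift := square_sum_shift (hdom m.+1 l) b0 (recentre_coef_cvg Kcomplete (hdom m.+1 l)).
apply: cvg_trans (@seq_cvgMl K m.+1%:R _ _ shift).
apply: near_eq_cvg; near=> n; rewrite -square_sumM; apply: eq_square_sum => i j _ _.
(* The identity (i+1) C(i, m) = (m+1) C(i+1, m+1) trades the factor of [dx] before recentring for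
   the factor after it. *)
rewrite /recentre_term subSS /=; have := congr1 (fun k => k%:R : K) (mul_bin_diag i.+1 m).
rewrite /= !natrM => E.
transitivity (g i.+1 j * (m.+1%:R * 'C(i.+1, m.+1)%:R * h.1 ^+ (i - m)) *
  ('C(j, l)%:R * h.2 ^+ (j - l))); first by ring.
by rewrite -E; ring.
Unshelve. all: by end_near. Qed.

Lemma near_recentre_du g :
  \forall h \near (0 : K * K), recentre h (du g) = du (recentre h g).
Proof.
have [M [D [D0 dom]]] := near_recentre_dominated g.
have [M' [D' [D0' dom']]] := near_recentre_dominated (du g).
near=> h; have gE : forall m l, recentre h g m l = recentre_coef h g m l.
  by near: h; exact: near_recentreE.
have dgE : forall m l, recentre h (du g) m l = recentre_coef h (du g) m l.
  by near: h; exact: near_recentreE.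
have hdom : forall m l, dominated (M * D ^+ (m + l)) 4^-1 (recentre_term h g m l).
  by near: h.
have hdom' : forall m l,
    dominated (M' * D' ^+ (m + l)) 4^-1 (recentre_term h (du g) m l).
  by near: h.
apply: germ_eq => m l; rewrite /= gE dgE.
apply: (seq_cvg_unique (recentre_coef_cvg Kcomplete (hdom' m l))).
have b0 j : recentre_term h g m l.+1 j 0 = 0.
  by rewrite /recentre_term bin0n mul0r mulr0.
(* Transposing the indices reduces the shift in the second index to [square_sum_shift]. *)
have swapE : square_sum (fun i j => recentre_term h g m l.+1 j i) =
    square_sum (recentre_term h g m l.+1).
  by apply/funext => n; exact: square_sum_swap.
have swap_dom : dominated (M * D ^+ (m + l.+1)) 4^-1
    (fun i j => recentre_term h g m l.+1 j i).
  by move=> i j; rewrite (addnC i); exact: hdom.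
have swap_cvg := recentre_coef_cvg Kcomplete (hdom m l.+1); rewrite -swapE in swap_cvg.
have shift := square_sum_shift swap_dom b0 swap_cvg.
apply: cvg_trans (@seq_cvgMl K l.+1%:R _ _ shift).
apply: near_eq_cvg; near=> n; rewrite -square_sumM -square_sum_swap.
apply: eq_square_sum => i j _ _.
rewrite /recentre_term subSS /=; have := congr1 (fun k => k%:R : K) (mul_bin_diag j.+1 l).
rewrite /= !natrM => E.
transitivity (g i j.+1 * ('C(i, m)%:R * h.1 ^+ (i - m)) *
  (l.+1%:R * 'C(j.+1, l.+1)%:R * h.2 ^+ (j - l))); first by ring.
by rewrite -E; ring.
Unshelve. all: by end_near. Qed.

(** Where the series has no limit the value is the default 0; only the behaviour near the origin
    carries information. *)
Definition germ_fun g h : K := xget 0 [set s | square_sum (term g h) @ \oo --> s].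

Lemma has_germ_fun g : has_germ (germ_fun g) 0 g.
Proof.
have [M gM] := near_term_dominated g.
near=> h; rewrite add0r.
have gh : dominated M 4^-1 (term g h) by near: h; apply: gM; rewrite invr_gt0.
exact: (@xgetPex _ 0 [set s : K | square_sum (term g h) @ \oo --> s]
  (square_sum_cvg Kcomplete gh)).
Unshelve. all: by end_near. Qed.

Lemma near_has_germ_fun g :
  \forall h \near (0 : K * K), has_germ (germ_fun g) h (recentre h g).
Proof.
have := has_germ_recentre Kcomplete (has_germ_fun g).
by apply: filterS => h; rewrite add0r.
Qed.

Lemma has_germ_sum (I : Type) (r : seq I) (f : I -> K * K -> K) a (g : I -> germ K) :
  (forall i, has_germ (f i) a (g i)) ->
  has_germ (fun y => \sum_(i <- r) f i y) a (\sum_(i <- r) g i).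
Proof.
move=> fg; elim: r => [|i r IHr].
  by rewrite big_nil; under eq_fun do rewrite big_nil; exact: has_germ_cst.
by rewrite big_cons; under eq_fun do rewrite big_cons; exact: has_germD.
Qed.

Lemma recentre_cst (k : K) :
  \forall h \near (0 : K * K), recentre h (cst_germ k) = cst_germ k.
Proof.
have := has_germ_recentre Kcomplete (has_germ_cst k (0 : K * K)).
by apply: filterS => h kh; apply: germ_unique kh (has_germ_cst _ _).
Qed.

Lemma near_recentreN g :
  \forall h \near (0 : K * K), recentre h (- g) = - recentre h g.
Proof.
have := has_germ_recentre Kcomplete (has_germZ (-1) (has_germ_fun g)).
have := near_has_germ_fun g; apply: filterS2 => h gh; rewrite add0r scaleN1r => Ngh.
apply: germ_unique Ngh _.
by rewrite -(scaleN1r (recentre h g)); exact: has_germZ.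
Qed.

(** Both sides are germs at [h] of the same functions, built from the [germ_fun] of the entries, so
    [germ_unique] applies. *)
Lemma near_recentre_mulmx m n p (A : 'M[germ K]_(m, n)) (B : 'M[germ K]_(n, p)) :
  \forall h \near (0 : K * K), map_mx (recentre h) (A *m B) =
    map_mx (recentre h) A *m map_mx (recentre h) B.
Proof.
have ABh : \forall h \near (0 : K * K), forall i j, has_germ
    (fun y => \sum_k germ_fun (A i k) y * germ_fun (B k j) y) h
    (recentre h (\sum_k A i k * B k j)).
  apply: (@filter_forall2 (K * K) 'I_m 'I_p (fun i j h => has_germ
    (fun y => \sum_k germ_fun (A i k) y * germ_fun (B k j) y) h
    (recentre h (\sum_k A i k * B k j))) (nbhs (0 : K * K)) _) => i j.
  have : has_germ (fun y => \sum_k germ_fun (A i k) y * germ_fun (B k j) y) 0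
      (\sum_k A i k * B k j).
    by apply: has_germ_sum => k; apply: has_germM => //; exact: has_germ_fun.
  by move=> /(has_germ_recentre Kcomplete); apply: filterS => h; rewrite add0r.
have Ah : \forall h \near (0 : K * K), forall i j,
    has_germ (germ_fun (A i j)) h (recentre h (A i j)).
  apply: (@filter_forall2 (K * K) 'I_m 'I_n (fun i j h =>
    has_germ (germ_fun (A i j)) h (recentre h (A i j))) (nbhs (0 : K * K)) _) => i j.
  exact: near_has_germ_fun.
have Bh : \forall h \near (0 : K * K), forall i j,
    has_germ (germ_fun (B i j)) h (recentre h (B i j)).
  apply: (@filter_forall2 (K * K) 'I_n 'I_p (fun i j h =>
    has_germ (germ_fun (B i j)) h (recentre h (B i j))) (nbhs (0 : K * K)) _) => i j.
  exact: near_has_germ_fun.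
move: ABh Ah Bh; apply: filterS3 => h ABh Ah Bh.
apply/matrixP => i j; rewrite !mxE; apply: germ_unique (ABh i j) _.
by apply: has_germ_sum => k; rewrite !mxE; exact: has_germM.
Qed.

End RecentringMorphism.

(** * Partial derivatives as commuting derivations *)

Section Derivations.
Variable K : numFieldType.
Implicit Types f g : germ K.

Lemma dx_is_linear : linear (@dx K).
Proof. by move=> k f g; apply: germ_eq => i j /=; rewrite mulrDr mulrCA. Qed.
HB.instance Definition _ :=
  GRing.isLinear.Build K (germ K) (germ K) *:%R (@dx K) dx_is_linear.

Lemma du_is_linear : linear (@du K).
Proof. by move=> k f g; apply: germ_eq => i j /=; rewrite mulrDr mulrCA. Qed.
HB.instance Definition _ :=
  GRing.isLinear.Build K (germ K) (germ K) *:%R (@du K) du_is_linear.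

(** The factor n + 1 splits as k + (n + 1 - k); the first part kills k = 0, the second k = n + 1. *)
Lemma leibniz_sum n (F : nat -> nat -> K) :
  n.+1%:R * \sum_(k < n.+2) F k (n.+1 - k)%N =
  \sum_(k < n.+1) k.+1%:R * F k.+1 (n - k)%N +
  \sum_(k < n.+1) (n - k).+1%:R * F k (n - k).+1.
Proof.
transitivity (\sum_(k < n.+2) k%:R * F k (n.+1 - k)%N +
    \sum_(k < n.+2) (n.+1 - k)%:R * F k (n.+1 - k)%N).
  rewrite mulr_sumr -big_split /=; apply: eq_bigr => k _.
  by rewrite -mulrDl -natrD subnKC // -ltnS.
rewrite big_ord_recl mul0r add0r; congr (_ + _).
rewrite big_ord_recr /= subnn mul0r addr0; apply: eq_bigr => k _.
by rewrite subSn // -ltnS.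
Qed.

Lemma dxM f g : dx (f * g) = dx f * g + f * dx g.
Proof.
apply: germ_eq => i j /=; rewrite /Defs.cauchy.
rewrite (leibniz_sum i (fun k k' => \sum_(l < j.+1) f k l * g k' (j - l)%N)).
congr (_ + _); apply: eq_bigr => k _; rewrite mulr_sumr; apply: eq_bigr => l _.
  by rewrite mulrA.
by rewrite mulrCA.
Qed.

Lemma duM f g : du (f * g) = du f * g + f * du g.
Proof.
apply: germ_eq => i j /=; rewrite /Defs.cauchy mulr_sumr -big_split /=.
apply: eq_bigr => k _; rewrite (leibniz_sum j (fun l l' => f k l * g (i - k)%N l')).
by congr (_ + _); apply: eq_bigr => l _; [rewrite mulrA|rewrite mulrCA].
Qed.

Lemma dx_cst (k : K) : dx (cst_germ k) = 0.
Proof. by apply: germ_eq => i j /=; rewrite mulr0 if_same. Qed.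

Lemma du_cst (k : K) : du (cst_germ k) = 0.
Proof. by apply: germ_eq => i j /=; rewrite addnS mulr0 if_same. Qed.

Lemma cst_germE (k : K) : cst_germ k = k *: (1 : germ K).
Proof. by apply: germ_eq => i j /=; case: ifP; rewrite (mulr0, mulr1). Qed.

Lemma dxdu f : dx (du f) = du (dx f).
Proof. by apply: germ_eq => i j /=; rewrite mulrCA. Qed.

Lemma germ_constant f : dx f = 0 -> du f = 0 -> f = cst_germ (f 0%N 0%N).
Proof.
move=> fx fu; apply: germ_eq => -[|i] j /=; last first.
  apply/eqP; rewrite -(mulrI_eq0 _ (@mulfI _ i.+1%:R _)) ?pnatr_eq0 //.
  by have := congr1 (fun g : germ K => g i j) fx => /= ->; rewrite if_same.
case: j => [//|j] /=; apply/eqP.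
rewrite -(mulrI_eq0 _ (@mulfI _ j.+1%:R _)) ?pnatr_eq0 //.
by have := congr1 (fun g : germ K => g 0 j)%N fu => /= ->; rewrite if_same.
Qed.

Lemma germ_sumE (I : Type) (r : seq I) (F : I -> germ K) i j :
  (\sum_(k <- r) F k) i j = \sum_(k <- r) F k i j.
Proof.
elim: r => [|k r IHr]; first by rewrite !big_nil /= if_same.
by rewrite !big_cons /= IHr.
Qed.

Lemma map_dxM m n p (A : 'M[germ K]_(m, n)) (B : 'M[germ K]_(n, p)) :
  map_mx (@dx K) (A *m B) = map_mx (@dx K) A *m B + A *m map_mx (@dx K) B.
Proof.
apply/matrixP => i j; rewrite !mxE raddf_sum -big_split /=.
by apply: eq_bigr => k _; rewrite dxM !mxE.
Qed.

Lemma map_duM m n p (A : 'M[germ K]_(m, n)) (B : 'M[germ K]_(n, p)) :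
  map_mx (@du K) (A *m B) = map_mx (@du K) A *m B + A *m map_mx (@du K) B.
Proof.
apply/matrixP => i j; rewrite !mxE raddf_sum -big_split /=.
by apply: eq_bigr => k _; rewrite duM !mxE.
Qed.

Lemma map_dxdu m n (A : 'M[germ K]_(m, n)) :
  map_mx (@dx K) (map_mx (@du K) A) = map_mx (@du K) (map_mx (@dx K) A).
Proof. by apply/matrixP => i j; rewrite !mxE dxdu. Qed.

Lemma constant_mx m n (A : 'M[germ K]_(m, n)) :
  map_mx (@dx K) A = 0 -> map_mx (@du K) A = 0 ->
  A = map_mx (@cst_germ K) (map_mx (fun g : germ K => g 0%N 0%N) A).
Proof.
move=> Ax Au; apply/matrixP => i j; rewrite !mxE; apply: germ_constant.
  by have := congr1 (fun M : 'M[germ K]_(m, n) => M i j) Ax; rewrite !mxE.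
by have := congr1 (fun M : 'M[germ K]_(m, n) => M i j) Au; rewrite !mxE.
Qed.

End Derivations.

(** Stands in for recursion on two indices: in degree d the iterates of [T] are stable after d + 1
    steps, so the entry (i, j) is read from the iterate i + j + 1. *)
Lemma degree_fixpoint (V : Type) (v : V) (T : (nat -> nat -> V) -> nat -> nat -> V) :
  (forall n Y Y', (forall i j, (i + j < n)%N -> Y i j = Y' i j) ->
    forall i j, (i + j < n.+1)%N -> T Y i j = T Y' i j) ->
  exists Y, forall i j, Y i j = T Y i j.
Proof.
move=> Tcausal; pose it n := iter n T (fun _ _ => v).
have stable n m i j : (i + j < n)%N -> (n <= m)%N -> it n i j = it m i j.
  elim: n m i j => [//|n IHn] [//|m] i j ijn nm.
  by apply: (Tcausal n) => // k l kln; exact: IHn.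
exists (fun i j => it (i + j).+1 i j) => i j.
by apply: (Tcausal (i + j)%N) => // k l kl; symmetry; exact: stable.
Qed.

(** * Fundamental matrices of flat linear systems *)

Section FundamentalSystems.
Variables (K : numFieldType) (n : nat).
Implicit Types A B Phi : 'M[germ K]_n.

Definition coef_mx A i j : 'M[K]_n := map_mx (fun g : germ K => g i j) A.

Lemma coef_mxM A B i j : coef_mx (A *m B) i j =
  \sum_(k < i.+1) \sum_(l < j.+1) coef_mx A k l *m coef_mx B (i - k) (j - l).
Proof.
apply/matrixP => r s; rewrite !mxE germ_sumE summxE.
under eq_bigr do rewrite /= /Defs.cauchy.
rewrite exchange_big; apply: eq_bigr => k _; rewrite summxE exchange_big.
by apply: eq_bigr => l _; rewrite mxE; apply: eq_bigr => t _; rewrite !mxE.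
Qed.

Lemma coef_mx_inj A B : (forall i j, coef_mx A i j = coef_mx B i j) -> A = B.
Proof.
move=> AB; apply/matrixP => r s; apply: germ_eq => i j.
by have := congr1 (fun M : 'M[K]_n => M r s) (AB i j); rewrite !mxE.
Qed.

(** Sums replace maxima because the order of [K] is partial; the extra 1 gives 1 <= L even for an
    empty matrix. *)
Lemma mx_common_bound A : exists M L : K, [/\ 0 <= M, 1 <= L &
  forall r s i j, `|A r s i j| <= M * L ^+ (i + j)].
Proof.
pose P (g : germ K) (ML : K * K) := [/\ 0 <= ML.1, 1 <= ML.2 &
  forall i j, `|g i j| <= ML.1 * ML.2 ^+ (i + j)].
have /choice[ML MLP] : forall g, exists ML, P g ML.
  move=> g; have [M [L [M0 L1 gML]]] := convergentP (coefs_convergent g).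
  by exists (M, L).
pose M r s := (ML (A r s)).1; pose L r s := (ML (A r s)).2.
have M0 r s : 0 <= M r s by have [] := MLP (A r s).
have L1 r s : 1 <= L r s by have [] := MLP (A r s).
have L0 r s : 0 <= L r s by exact: le_trans (L1 r s).
exists (\sum_r \sum_s M r s), (1 + \sum_r \sum_s L r s); split.
- by apply: sumr_ge0 => r _; exact: sumr_ge0.
- by rewrite lerDl; apply: sumr_ge0 => r _; exact: sumr_ge0.
move=> r s i j; have [_ _ /(_ i j) AML] := MLP (A r s); apply: le_trans AML _.
have entry_le (F : 'I_n -> 'I_n -> K) : (forall r s, 0 <= F r s) ->
    F r s <= \sum_r \sum_s F r s.
  move=> F0; rewrite (bigD1 r) //= (bigD1 s) //= -addrA lerDl addr_ge0 //.
    exact: sumr_ge0.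
  by apply: sumr_ge0 => k _; exact: sumr_ge0.
apply: (@ler_pM _ (M r s) _ (L r s ^+ (i + j))); rewrite ?exprn_ge0 ?entry_le //.
apply: lerXn2r; rewrite ?nnegrE ?(le_trans (L0 r s)) //.
  by apply: le_trans (entry_le L L0) _; rewrite lerDr.
by apply: le_trans (entry_le L L0) _; rewrite lerDr.
Qed.

(* The coefficients are determined by the equation along u, and by the equation
   along x on the line u = 0. *)
Lemma formal_solution A B : exists Y : nat -> nat -> 'M[K]_n, [/\
  Y 0%N 0%N = 1%:M,
  forall i, i.+1%:R *: Y i.+1 0%N = \sum_(k < i.+1) Y k 0%N *m coef_mx A (i - k) 0%N &
  forall i j, j.+1%:R *: Y i j.+1 =
    \sum_(k < i.+1) \sum_(l < j.+1) Y k l *m coef_mx B (i - k) (j - l)].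
Proof.
pose T (Y : nat -> nat -> 'M[K]_n) i j : 'M[K]_n := match i, j with
  | 0, 0 => 1%:M
  | i.+1, 0 => i.+1%:R^-1 *: \sum_(k < i.+1) Y k 0%N *m coef_mx A (i - k) 0%N
  | i, j.+1 => j.+1%:R^-1 *:
      \sum_(k < i.+1) \sum_(l < j.+1) Y k l *m coef_mx B (i - k) (j - l)
  end.
have T_u Y i j : T Y i j.+1 = j.+1%:R^-1 *:
    \sum_(k < i.+1) \sum_(l < j.+1) Y k l *m coef_mx B (i - k) (j - l) by case: i.
have [m Y Y' YY' i j ijm|Y YT] := @degree_fixpoint _ 0 T.
  case: j ijm => [|j] ijm.
    case: i ijm => [//|i]; rewrite addn0 ltnS /= => im; congr (_ *: _).
    apply: eq_bigr => k _; rewrite YY' // addn0; apply: leq_trans im; exact: ltn_ord.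
  rewrite !T_u; congr (_ *: _); apply: eq_bigr => k _; apply: eq_bigr => l _.
  by rewrite YY' //; have := ltn_ord k; have := ltn_ord l; lia.
exists Y; split=> [|i|i j]; first exact: YT.
  by rewrite {1}YT /= scalerA mulfV ?pnatr_eq0 // scale1r.
by rewrite {1}YT T_u scalerA mulfV ?pnatr_eq0 // scale1r.
Qed.

(** A majorant argument, |Y i j| <= G^(i+j) by induction on the total degree. The integer on the
    left of each recursion cancels the number of terms in the sum over the differentiated index; in
    the equation along u the remaining sum is geometric. *)
Lemma formal_solution_convergent A B (Y : nat -> nat -> 'M[K]_n) :
  Y 0%N 0%N = 1%:M ->
  (forall i, i.+1%:R *: Y i.+1 0%N =
    \sum_(k < i.+1) Y k 0%N *m coef_mx A (i - k) 0%N) ->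
  (forall i j, j.+1%:R *: Y i j.+1 =
    \sum_(k < i.+1) \sum_(l < j.+1) Y k l *m coef_mx B (i - k) (j - l)) ->
  forall r s, convergent (fun i j => Y i j r s).
Proof.
move=> Y0 Yx Yu r s.
have [MA [LA [MA0 LA1 bA]]] := mx_common_bound A.
have [MB [LB [MB0 LB1 bB]]] := mx_common_bound B.
pose M := MA + MB; pose L := LA + LB.
have M0 : 0 <= M by exact: addr_ge0.
have LA0 : 0 <= LA by exact: le_trans LA1.
have LB0 : 0 <= LB by exact: le_trans LB1.
have bound (C : 'M[germ K]_n) M' L' : 0 <= M' -> 0 <= L' -> M' <= M -> L' <= L ->
    (forall r s i j, `|C r s i j| <= M' * L' ^+ (i + j)) ->
    forall r s i j, `|C r s i j| <= M * L ^+ (i + j).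
  move=> M'0 L'0 M'M L'L CML r' s' i j; apply: le_trans (CML _ _ _ _) _.
  by apply: ler_pM; rewrite ?exprn_ge0 // lerXn2r // nnegrE (le_trans L'0).
have {}bA : forall r s i j, `|A r s i j| <= M * L ^+ (i + j).
  by apply: bound bA => //; rewrite lerDl.
have {}bB : forall r s i j, `|B r s i j| <= M * L ^+ (i + j).
  by apply: bound bB => //; rewrite lerDr.
have L1 : 1 <= L by apply: le_trans LA1 _; rewrite lerDl.
have L0 : 0 <= L by exact: le_trans L1.
(* The part 2 L gives L <= G / 2, hence powers of 1/2 to sum; the part 2 n M absorbs the n terms of
   a matrix entry, the bound M and that geometric sum, at most 2. *)
pose G := 2 * (n%:R * M) + 2 * L.
have nM0 : 0 <= n%:R * M by rewrite mulr_ge0.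
have G1 : 1 <= G.
  apply: le_trans L1 _; apply: le_trans (_ : 2 * L <= _).
    by rewrite ler_peMl // ler1n.
  by rewrite lerDr mulr_ge0.
have G0 : 0 <= G by exact: le_trans G1.
have LG : L <= 2^-1 * G.
  by rewrite mulrDr !mulKf ?pnatr_eq0 // lerDr.
have nMG : 2 * (n%:R * M) <= G by rewrite lerDl mulr_ge0.
exists 1, G => i j; rewrite mul1r.
suff : forall d i j, (i + j <= d)%N -> forall r s, `|Y i j r s| <= G ^+ (i + j).
  by move=> /(_ (i + j)%N i j (leqnn _)); apply.
elim=> [|d IHd] {}i {}j ijd {}r {}s.
  move: ijd; rewrite leqn0 addn_eq0 => /andP[/eqP-> /eqP->].
  by rewrite Y0 mxE; case: eqP; rewrite ?normr0 ?normr1.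
have prod_le (C : 'M[germ K]_n) k l k' l' : (k + l <= d)%N ->
    (forall r s i j, `|C r s i j| <= M * L ^+ (i + j)) ->
    `|(Y k l *m coef_mx C k' l') r s| <= n%:R * M * (G ^+ (k + l) * (2^-1 * G) ^+ (k' + l')).
  move=> kld bC; rewrite mxE; apply: le_trans (ler_norm_sum _ _ _) _.
  apply: le_trans (_ : \sum_(t < n) G ^+ (k + l) * (M * (2^-1 * G) ^+ (k' + l')) <= _).
    apply: ler_sum => t _; rewrite normrM ler_pM // ?IHd // mxE.
    apply: le_trans (bC _ _ _ _) _; rewrite ler_wpM2l // lerXn2r // nnegrE //.
    exact: le_trans LG.
  rewrite sumr_const card_ord -[leLHS]mulr_natl -subr_ge0.
  by rewrite [X in 0 <= X](_ : _ = 0) //; ring.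
have half1 m : 2^-1 ^+ m <= 1 :> K by rewrite exprn_ile1 ?invr_ge0 // invf_le1 ?ler1n.
case: j ijd => [|j] ijd.
  case: i ijd => [_|i]; first by rewrite Y0 mxE; case: eqP; rewrite ?normr0 ?normr1.
  rewrite addn0 ltnS => id_.
  rewrite -(ler_pM2l (_ : 0 < i.+1%:R)) ?ltr0Sn // -{1}[i.+1%:R]normr_nat -normrM.
  have := congr1 (fun N : 'M[K]_n => N r s) (Yx i); rewrite mxE => ->.
  rewrite summxE; apply: le_trans (ler_norm_sum _ _ _) _.
  rewrite mulr_natl -[X in _ *+ X](card_ord i.+1) -sumr_const; apply: ler_sum => k _.
  have ki : (k <= i)%N by rewrite -ltnS.
  apply: le_trans (prod_le A k 0%N (i - k)%N 0%N _ bA) _.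
    by rewrite addn0 (leq_trans ki).
  rewrite !addn0 exprMn.
  have -> : n%:R * M * (G ^+ k * (2^-1 ^+ (i - k) * G ^+ (i - k))) =
      2^-1 ^+ (i - k) * (n%:R * M * G ^+ i).
    have -> : G ^+ i = G ^+ k * G ^+ (i - k) by rewrite -exprD subnKC.
    by ring.
  rewrite exprS; apply: le_trans (_ : n%:R * M * G ^+ i <= _).
    by rewrite ler_piMl // mulr_ge0 ?exprn_ge0.
  rewrite ler_wpM2r ?exprn_ge0 //; apply: le_trans nMG.
  by rewrite ler_peMl // ler1n.
rewrite -(ler_pM2l (_ : 0 < j.+1%:R)) ?ltr0Sn // -{1}[j.+1%:R]normr_nat -normrM.
have := congr1 (fun N : 'M[K]_n => N r s) (Yu i j); rewrite mxE => ->.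
rewrite summxE; apply: le_trans (ler_norm_sum _ _ _) _.
have geo m : \sum_(k < m.+1) 2^-1 ^+ (m - k) <= 2 :> K.
  suff -> : \sum_(k < m.+1) 2^-1 ^+ (m - k) = 2 - 2^-1 ^+ m :> K.
    by rewrite gerBl exprn_ge0 ?invr_ge0.
  elim: m => [|m IHm]; first by rewrite big_ord1 subnn expr0; ring.
  rewrite big_ord_recr subnn; under eq_bigr => k _ do rewrite /= subSn -1?ltnS // exprS.
  rewrite -mulr_sumr IHm /= exprS mulrBr mulVf ?pnatr_eq0 //; ring.
apply: le_trans (_ : \sum_(k < i.+1) j.+1%:R * (n%:R * M * G ^+ (i + j)) * 2^-1 ^+ (i - k) <= _).
  apply: ler_sum => k _; rewrite summxE; apply: le_trans (ler_norm_sum _ _ _) _.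
  rewrite -[leRHS]mulrA mulr_natl -[X in _ *+ X](card_ord j.+1) -sumr_const.
  have ki : (k <= i)%N by rewrite -ltnS.
  apply: ler_sum => l _; have lj : (l <= j)%N by rewrite -ltnS.
  apply: le_trans (prod_le B k l (i - k)%N (j - l)%N _ bB) _.
    by move: ijd; rewrite addnS ltnS; apply: leq_trans; exact: leq_add.
  have -> : (i + j = (k + l) + ((i - k) + (j - l)))%N by rewrite addnACA !subnKC.
  rewrite exprMn [G ^+ (_ + (_ + _))]exprD [2^-1 ^+ (_ + _)]exprD.
  set a := G ^+ _; set b := G ^+ _.
  have -> : n%:R * M * (a * (2^-1 ^+ (i - k) * 2^-1 ^+ (j - l) * b)) =
      2^-1 ^+ (j - l) * (n%:R * M * (a * b) * 2^-1 ^+ (i - k)) by ring.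
  by rewrite ler_piMl // !mulr_ge0 ?exprn_ge0 ?invr_ge0.
rewrite -mulr_sumr addnS exprS -mulrA ler_wpM2l // mulrAC ler_wpM2r ?exprn_ge0 //.
by rewrite mulrC; apply: le_trans nMG; rewrite ler_wpM2r.
Qed.

(** The equation expresses the coefficients of order j + 1 in u through those of order at most j, so
    vanishing on u = 0 propagates. *)
Lemma matrix_ode_unique B E : map_mx (@du K) E = E *m B ->
  (forall i, coef_mx E i 0 = 0) -> E = 0.
Proof.
move=> Eu E0; apply: coef_mx_inj => i j.
have -> : coef_mx 0 i j = 0 by apply/matrixP => r s; rewrite !mxE /= if_same.
elim/ltn_ind: j i => -[|j] IHj i; first exact: E0.
have := congr1 (fun N => coef_mx N i j) Eu; rewrite coef_mxM.
rewrite [RHS]big1 => [duE|k _]; last first.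
  by rewrite big1 // => l _; rewrite IHj ?mul0mx.
have : j.+1%:R *: coef_mx E i j.+1 = 0.
  by rewrite -duE; apply/matrixP => r s; rewrite !mxE.
by move=> /eqP; rewrite scaler_eq0 pnatr_eq0 => /eqP.
Qed.

(* Flatness makes dx Phi - Phi A a solution E of du E = E B that vanishes on u = 0. *)
Lemma fundamental_system A B :
  map_mx (@du K) A + B *m A = map_mx (@dx K) B + A *m B ->
  exists Phi, [/\ map_mx (@dx K) Phi = Phi *m A, map_mx (@du K) Phi = Phi *m B &
    coef_mx Phi 0 0 = 1%:M].
Proof.
move=> flatAB; have [Y [Y0 Yx Yu]] := formal_solution A B.
have Yc := formal_solution_convergent Y0 Yx Yu.
pose Phi : 'M[germ K]_n := \matrix_(r, s) Germ (Yc r s).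
have PhiE i j : coef_mx Phi i j = Y i j by apply/matrixP => r s; rewrite !mxE.
have Phiu : map_mx (@du K) Phi = Phi *m B.
  apply: coef_mx_inj => i j; rewrite coef_mxM.
  under eq_bigr do under eq_bigr do rewrite PhiE.
  by rewrite -Yu; apply/matrixP => r s; rewrite !mxE.
exists Phi; split=> //; last by rewrite PhiE.
apply/eqP; rewrite -subr_eq0; apply/eqP.
apply: (@matrix_ode_unique B) => [|i]; last first.
  have -> (M N : 'M[germ K]_n) : coef_mx (M - N) i 0 = coef_mx M i 0 - coef_mx N i 0.
    by apply/matrixP => r s; rewrite !mxE.
  rewrite coef_mxM; under eq_bigr do rewrite big_ord1 PhiE.
  by rewrite -Yx; apply/matrixP => r s; rewrite !mxE subrr.
(* The derivative along u of E is (dx Phi) B + Phi (dx B) - Phi B A - Phi (du A); flatness turns it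
   into (dx Phi - Phi A) B. *)
rewrite map_mxB map_duM -map_dxdu Phiu map_dxM mulmxBl -!mulmxA.
by rewrite -mulmxDr [B *m A + _]addrC flatAB mulmxDr opprD addrA addrK.
Qed.

(* The transposed inverse solves the dual system, with matrices - A^T and - B^T. *)
Lemma fundamental_inverse A B Phi :
  map_mx (@du K) A + B *m A = map_mx (@dx K) B + A *m B ->
  map_mx (@dx K) Phi = Phi *m A -> map_mx (@du K) Phi = Phi *m B ->
  coef_mx Phi 0 0 = 1%:M ->
  exists Psi, [/\ map_mx (@dx K) Psi = - (A *m Psi), map_mx (@du K) Psi = - (B *m Psi),
    Phi *m Psi = 1%:M & Psi *m Phi = 1%:M].
Proof.
move=> flatAB Phix Phiu Phi0.
have flatT : map_mx (@du K) (- A^T) + (- B^T) *m (- A^T) =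
    map_mx (@dx K) (- B^T) + (- A^T) *m (- B^T).
  have -> : map_mx (@du K) (- A^T) = - (map_mx (@du K) A)^T by rewrite map_mxN map_trmx.
  have -> : map_mx (@dx K) (- B^T) = - (map_mx (@dx K) B)^T by rewrite map_mxN map_trmx.
  rewrite !mulNmx !mulmxN !opprK -!trmx_mul.
  have -> : A *m B = map_mx (@du K) A + (B *m A - map_mx (@dx K) B).
    by rewrite addrA flatAB addrAC subrr add0r.
  by rewrite linearD linearB /= addKr addrC.
have [X [Xx Xu X0]] := fundamental_system flatT.
have Psix : map_mx (@dx K) X^T = - (A *m X^T).
  by rewrite -map_trmx Xx mulmxN linearN /= trmx_mul trmxK.
have Psiu : map_mx (@du K) X^T = - (B *m X^T).
  by rewrite -map_trmx Xu mulmxN linearN /= trmx_mul trmxK.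
(* Both derivatives of the product cancel, so it equals its value at the origin. The product in the
   other order follows because the matrices are square over a commutative ring. *)
have PhiPsi : Phi *m X^T = 1%:M.
  rewrite (@constant_mx _ _ _ (Phi *m X^T)).
  - have -> : map_mx (fun g : germ K => g 0%N 0%N) (Phi *m X^T) = 1%:M.
      rewrite -[LHS]/(coef_mx _ 0 0) coef_mxM !big_ord1 Phi0 mul1mx.
      by rewrite /coef_mx -map_trmx -[map_mx _ X]/(coef_mx X 0 0) X0 trmx1.
    by apply/matrixP => r s; rewrite !mxE; case: eqP.
  - by rewrite map_dxM Phix Psix mulmxN mulmxA subrr.
  - by rewrite map_duM Phiu Psiu mulmxN mulmxA subrr.
by exists X^T; split => //; exact: mulmx1C.
Qed.

End FundamentalSystems.

Lemma big_ord3 (V : nmodType) (F : 'I_3 -> V) : \sum_(m < 3) F m = F 0 + F 1 + F 2.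
Proof.
rewrite !big_ord_recl big_ord0 addr0 addrA.
by congr (F _ + F _ + F _); exact/val_inj.
Qed.

Lemma ord3P (P : 'I_3 -> Prop) : P 0 -> P 1 -> P 2 -> forall k, P k.
Proof.
move=> P0 P1 P2 [[|[|[|//]]] k3].
- by have -> : Ordinal k3 = 0 by exact/val_inj.
- by have -> : Ordinal k3 = 1 by exact/val_inj.
- by have -> : Ordinal k3 = 2 by exact/val_inj.
Qed.

(** * Connection matrices, curvature and horizontal rows *)

Section Connection.
Variables (K : numFieldType) (S : system (germ K)).
Local Notation O := (germ K).
Implicit Types v : 'rV[O]_3.

(* A row v = (z, p, q) is the 1-jet of a section of R_0; column j of these
   matrices expresses the derivative of its j-th entry imposed by the system. *)
Definition conn_x : 'M[O]_3 := \matrix_(k, j) [:: z10 K; z20 S; z11 S]`_j 0 k.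
Definition conn_y : 'M[O]_3 := \matrix_(k, j) [:: z01 K; z11 S; z02 S]`_j 0 k.

Lemma pi_inv_is_linear : linear (@Defs.pi_inv K S).
Proof.
move=> a u v; apply: val_inj => /=.
apply/rowP; case=> [[|[|[|[|[|[|//]]]]]] lt_k6]; rewrite !mxE /= ?mxE /=; ring.
Qed.
HB.instance Definition _ :=
  GRing.isLinear.Build O 'rV[O]_3 (R0 S) *:%R (@Defs.pi_inv K S) pi_inv_is_linear.

Lemma R0_free : free_of_rank (R0 S) 3.
Proof. by exists (@Defs.pi_inv K S); exists (@Defs.pi_ K S); [exact: pi_invK|exact: pi_K]. Qed.

Lemma nabla0_pi_inv v : nabla0 S (Defs.pi_inv S v) =
  (Defs.pi_inv S (map_mx (@dx K) v - v *m conn_x),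
   Defs.pi_inv S (map_mx (@du K) v - v *m conn_y)).
Proof.
by congr (Defs.pi_inv S _, Defs.pi_inv S _); apply/rowP; apply: ord3P;
  rewrite !mxE /= ?mxE !big_ord3 ?mxE /= ?mxE /=; ring.
Qed.

Lemma nabla0_connection : is_connection (nabla0 S).
Proof.
split=> [s t|f s].
  rewrite -(pi_K s) -(pi_K t) -linearD /= !nabla0_pi_inv /=.
  apply: (congr2 pair).
    by rewrite /= -(linearD (@Defs.pi_inv K S)) /= map_mxD mulmxDl opprD addrACA.
  by rewrite /= -(linearD (@Defs.pi_inv K S)) /= map_mxD mulmxDl opprD addrACA.
rewrite -(pi_K s) -linearZ /= !nabla0_pi_inv.
have leibniz (d : germ K -> germ K) (M : 'M[O]_3) (u : 'rV[O]_3) :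
    (forall g g', d (g * g') = d g * g' + g * d g') ->
    map_mx d (f *: u) - f *: u *m M = d f *: u + f *: (map_mx d u - u *m M).
  move=> dM; rewrite scalerBr addrA -scalemxAl; congr (_ - _).
  by apply/rowP => k; rewrite !mxE dM.
apply: (congr2 pair); rewrite leibniz; [|exact: dxM| |exact: duM];
  by rewrite /= (linearD (@Defs.pi_inv K S)) 2!(linearZ_LR (@Defs.pi_inv K S)).
Qed.

Definition conn_curvature : 'M[O]_3 :=
  map_mx (@du K) conn_x + conn_y *m conn_x - (map_mx (@dx K) conn_y + conn_x *m conn_y).

Lemma curvature_pi_inv v :
  curvature (nabla0 S) (Defs.pi_inv S v) = Defs.pi_inv S (v *m conn_curvature).
Proof.
have nabla1E u : (nabla0 S (Defs.pi_inv S u)).1 =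
    Defs.pi_inv S (map_mx (@dx K) u - u *m conn_x) by rewrite nabla0_pi_inv.
have nabla2E u : (nabla0 S (Defs.pi_inv S u)).2 =
    Defs.pi_inv S (map_mx (@du K) u - u *m conn_y) by rewrite nabla0_pi_inv.
rewrite /curvature /nabla1 (nabla1E v) (nabla2E v) nabla1E nabla2E.
rewrite -(linearB (@Defs.pi_inv K S)) /=; congr Defs.pi_inv.
rewrite /conn_curvature !map_mxB !map_dxM !map_duM !map_dxdu.
(* Here [x] is the mixed second derivative of [v], [a] is (dx v) B and [c] is (du v) A. They cancel,
   which leaves an expression linear in [v] over the germs. *)
have cancel_terms (x a b c d e f : 'rV[O]_3) :
    x - (a + b) - (c - d) - (x - (c + e) - (a - f)) = e + d - (b + f).
  by apply/rowP => k; rewrite !mxE; ring.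
rewrite !(mulmxBl, mulmxBr, mulmxDr) !mulmxA; exact: cancel_terms.
Qed.

Lemma flat_conn_curvature : flat (nabla0 S) <-> conn_curvature = 0.
Proof.
split=> [fl|c0 s]; last by rewrite -(pi_K s) curvature_pi_inv c0 mulmx0 linear0.
apply/row_matrixP => i; rewrite rowE row0.
have := fl (Defs.pi_inv S (delta_mx 0 i)); rewrite curvature_pi_inv -(linear0 (@Defs.pi_inv K S)).
exact: (can_inj (@pi_invK K S)).
Qed.

(** The derivative of z_x along u and that of z_u along x are both replaced by the same row
    [z11]. *)
Lemma conn_curvature0 k : conn_curvature k 0 = 0.
Proof.
rewrite !mxE !big_ord3 !mxE /= ?mxE; move: k; apply: ord3P;
  rewrite /= ?(raddf0, dx_cst, du_cst); ring.
Qed.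

(** Multiplying by [conn_y] on the left substitutes for the derivatives that appear when a linear
    form is differentiated along u; with the derivatives of its coefficients this is [total_du]. The
    other half is [total_dx] likewise. *)
Lemma conn_curvature1 k :
  conn_curvature k 1 = (total_du S (z20 S) - total_dx S (z11 S)) 0 k.
Proof. by rewrite !mxE !big_ord3 !mxE /=; ring. Qed.

(** The sign is opposite to that of the second integrability condition, hence [opp_entry] in the
    proof of the equivalence. *)
Lemma conn_curvature2 k :
  conn_curvature k 2 = (total_du S (z11 S) - total_dx S (z02 S)) 0 k.
Proof. by rewrite !mxE !big_ord3 !mxE /=; ring. Qed.

Lemma flat_integrability : flat (nabla0 S) <-> integrability_conditions S.
Proof.
have opp_entry (a b : 'rV[O]_3) k : (a - b) 0 k = - (b - a) 0 k.
  by rewrite -opprB mxE.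
rewrite flat_conn_curvature; split=> [c0|[i1 i2]].
  split=> k; first by rewrite -conn_curvature1 c0 mxE.
  by rewrite opp_entry -conn_curvature2 c0 mxE oppr0.
apply/matrixP => k j; rewrite [RHS]mxE; move: j; apply: ord3P.
- exact: conn_curvature0.
- by rewrite conn_curvature1 i1.
- by rewrite conn_curvature2 opp_entry i2 oppr0.
Qed.

Lemma horizontal_pi_inv v : horizontal (nabla0 S) (Defs.pi_inv S v) <->
  map_mx (@dx K) v = v *m conn_x /\ map_mx (@du K) v = v *m conn_y.
Proof.
have pi_inv0 u : Defs.pi_inv S u = 0 -> u = 0.
  by rewrite -(linear0 (@Defs.pi_inv K S)); exact: (can_inj (@pi_invK K S)).
rewrite /horizontal nabla0_pi_inv; split=> [E|[-> ->]].
  by have /pi_inv0/subr0_eq -> := congr1 fst E; have /pi_inv0/subr0_eq -> := congr1 snd E.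
by rewrite !subrr !(linear0 (@Defs.pi_inv K S)).
Qed.

(** The first columns force p = dx z and q = du z; the other columns are then the three equations,
    the mixed one occurring twice. *)
Lemma horizontal_solution v :
  map_mx (@dx K) v = v *m conn_x -> map_mx (@du K) v = v *m conn_y ->
  is_solution S (v 0 0) /\ v = mkrow 3 [:: v 0 0; dx (v 0 0); du (v 0 0)].
Proof.
move=> /rowP vx /rowP vu.
have := vx 0; have := vx 1; have := vx 2; have := vu 0; have := vu 1; have := vu 2.
rewrite !mxE !big_ord3 !mxE /= ?mxE /=.
move=> u2 u1 u0 x2 x1 x0.
have p1 : v 0 1 = dx (v 0 0) by rewrite x0; ring.
have p2 : v 0 2 = du (v 0 0) by rewrite u0; ring.
split; last by apply/rowP; apply: ord3P; rewrite !mxE.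
split; rewrite -p1 -p2 ?x1 ?x2 ?u2 ?u1; ring.
Qed.

Lemma solution_horizontal (z : O) : is_solution S z ->
  map_mx (@dx K) (mkrow 3 [:: z; dx z; du z]) = mkrow 3 [:: z; dx z; du z] *m conn_x /\
  map_mx (@du K) (mkrow 3 [:: z; dx z; du z]) = mkrow 3 [:: z; dx z; du z] *m conn_y.
Proof.
move=> [s1 s2 s3].
have move_left (a b : O) : a + b = 0 -> a = - b.
  by move=> /eqP; rewrite addr_eq0 => /eqP.
rewrite -!addrA in s1 s2 s3.
by split; apply/rowP; apply: ord3P; rewrite !mxE !big_ord3 !mxE /= ?mxE /=
  -?dxdu ?(move_left _ _ s1) ?(move_left _ _ s2) ?(move_left _ _ s3); ring.
Qed.

End Connection.

(** * Horizontal frames at nearby points *)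

Section Frames.
Variable K : numFieldType.
Hypothesis Kcomplete : geometrically_complete K.
Implicit Types (a b h : K * K) (S : system (germ K)) (F : system (K * K -> K)).

Lemma near_translate a (P : K * K -> Prop) :
  (\forall b \near a, P b) -> \forall h \near (0 : K * K), P (a + h).
Proof.
move=> /nbhs_ballP[e /= e0 eP]; apply/near0P; exists (e / 2).
  by rewrite divr_gt0.
have e2 : e / 2 < e by rewrite ltr_pdivrMr // ltr_pMr // ltr1n.
move=> h h1 h2; apply: eP; split; rewrite -ball_normE /= opprD addNKr normrN;
  exact: le_lt_trans e2.
Qed.

Lemma translate_near a (P : K * K -> Prop) :
  (\forall h \near (0 : K * K), P (a + h)) -> \forall b \near a, P b.
Proof.
move=> /nbhs_ballP[e /= e0 eP]; apply/nbhs_ballP; exists e => // b [b1 b2].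
rewrite -(subrK a b) addrC; apply: eP.
split; rewrite -ball_normE /= sub0r opprB; [move: b1|move: b2]; by rewrite -ball_normE.
Qed.

Lemma has_germ_near_at (f f' : K * K -> K) a g : (\forall b \near a, f b = f' b) ->
  has_germ f a g -> has_germ f' a g.
Proof. by move=> /near_translate; exact: has_germ_near. Qed.

Lemma near_eq_at (f f' : K * K -> K) a g :
  has_germ f a g -> has_germ f' a g -> \forall b \near a, f b = f' b.
Proof. by move=> fg f'g; apply: translate_near; exact: has_germ_near_eq fg f'g. Qed.

Lemma has_germs_mulmx m n (w : K * K -> 'rV[K]_m) (P : K * K -> 'M[K]_(m, n)) a
    (v : 'rV[germ K]_m) (Phi : 'M[germ K]_(m, n)) :
  has_germs w a v -> (forall i j, has_germ (fun y => P y i j) a (Phi i j)) ->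
  has_germs (fun y => w y *m P y) a (v *m Phi).
Proof.
move=> wv PPhi j; rewrite mxE; under eq_fun do rewrite mxE.
by apply: has_germ_sum => i; apply: has_germM.
Qed.

Lemma has_germs_cst n (k : 'rV[K]_n) a : has_germs (fun=> k) a (map_mx (@cst_germ K) k).
Proof. by move=> j; rewrite mxE; exact: has_germ_cst. Qed.

(** A sheaf section and a frame each bring their own system germ at a point; this identifies the
    two. *)
Lemma has_system_germ_unique F a S S' :
  has_system_germ F a S -> has_system_germ F a S' -> S = S'.
Proof.
case: S => ? ? ? ? ? ? ? ? ? [[a1 a2 a3] [[b1 b2 b3] [c1 c2 c3]]].
case: S' => ? ? ? ? ? ? ? ? ? [[a1' a2' a3'] [[b1' b2' b3'] [c1' c2' c3']]].
move: a1 a2 a3 b1 b2 b3 c1 c2 c3 a1' a2' a3' b1' b2' b3' c1' c2' c3' => /=.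
move=> a1 a2 a3 b1 b2 b3 c1 c2 c3.
move=> /(germ_unique a1)-> /(germ_unique a2)-> /(germ_unique a3)->.
move=> /(germ_unique b1)-> /(germ_unique b2)-> /(germ_unique b3)->.
by move=> /(germ_unique c1)-> /(germ_unique c2)-> /(germ_unique c3)->.
Qed.

(** Pointwise counterpart of [lift_jet]: sheaf sections take all six jet coordinates as values,
    whereas frames record only z, p, q. *)
Definition lift_value F b (w : 'rV[K]_3) : 'rV[K]_6 :=
  \row_k [:: w 0 0; w 0 1; w 0 2;
             - (p3 F b * w 0 1 + q3 F b * w 0 2 + r3 F b * w 0 0);
             - (p2 F b * w 0 1 + q2 F b * w 0 2 + r2 F b * w 0 0);
             - (p1 F b * w 0 1 + q1 F b * w 0 2 + r1 F b * w 0 0)]`_k.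

Definition one_jet (s : 'rV[K]_6) : 'rV[K]_3 := \row_k [:: s 0 0; s 0 1; s 0 2]`_k.

Lemma lift_valueK F b : cancel (lift_value F b) one_jet.
Proof. by move=> w; apply/rowP; apply: ord3P; rewrite !mxE /= ?mxE. Qed.

Lemma lift_value_linear F b : linear (lift_value F b).
Proof.
move=> k u v; apply/rowP; case=> [[|[|[|[|[|[|//]]]]]] lt_k6]; rewrite !mxE /= ?mxE /=; ring.
Qed.

Lemma has_germN (f : K * K -> K) a g : has_germ f a g -> has_germ (fun y => - f y) a (- g).
Proof.
move=> fg; rewrite -(scaleN1r g); have := has_germZ (-1) fg.
by under eq_fun do rewrite mulN1r.
Qed.

Lemma has_germs_lift F S a (w : K * K -> 'rV[K]_3) (v : 'rV[germ K]_3) :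
  has_system_germ F a S -> has_germs w a v ->
  has_germs (fun y => lift_value F y (w y)) a (lift_jet S v).
Proof.
move=> [[P1 P2 P3] [[Q1 Q2 Q3] [R1 R2 R3]]] wv.
have lin (cp cq cr : K * K -> K) (gp gq gr : germ K) :
    has_germ cp a gp -> has_germ cq a gq -> has_germ cr a gr ->
    has_germ (fun y => - (cp y * w y 0 1 + cq y * w y 0 2 + cr y * w y 0 0)) a
      (- (gp * v 0 1 + gq * v 0 2 + gr * v 0 0)).
  move=> cgp cgq cgr; apply: has_germN; apply: has_germD; first apply: has_germD;
  by apply: (has_germM Kcomplete) => //; exact: wv.
case=> [[|[|[|[|[|[|//]]]]]] lt_k6]; rewrite [X in has_germ _ _ X]mxE;
  under eq_fun do rewrite mxE; rewrite [X in has_germ _ _ X]/=;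
  [exact: (wv 0)|exact: (wv 1)|exact: (wv 2)|exact: lin|exact: lin|exact: lin].
Qed.

Lemma has_germs_one_jet (s : K * K -> 'rV[K]_6) a S (sigma : R0 S) :
  has_germs s a sigma -> has_germs (fun y => one_jet (s y)) a (Defs.pi_ sigma).
Proof.
by move=> ss; apply: ord3P; rewrite !mxE /=; under eq_fun do rewrite !mxE /=; exact: ss.
Qed.

Lemma has_germs_center n (f : K * K -> 'rV[K]_n) a (g : 'rV[germ K]_n) :
  has_germs f a g -> f a = map_mx (fun x : germ K => x 0%N 0%N) g.
Proof. by move=> fg; apply/rowP => j; rewrite mxE; exact: has_germ_center (fg j). Qed.

(* P is a matrix of functions whose rows are, near a, a basis of the horizontal
   sections (in the coordinates z, p, q), and Q is its inverse. *)
Definition frame_at F (P Q : K * K -> 'M[K]_3) S (Phi Psi : 'M[germ K]_3) a : Prop :=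
  [/\ has_system_germ F a S,
      (forall i j, has_germ (fun y => P y i j) a (Phi i j)) /\
        (forall i j, has_germ (fun y => Q y i j) a (Psi i j)),
      map_mx (@dx K) Phi = Phi *m conn_x S /\ map_mx (@du K) Phi = Phi *m conn_y S,
      map_mx (@dx K) Psi = - (conn_x S *m Psi) /\
        map_mx (@du K) Psi = - (conn_y S *m Psi) &
      Phi *m Psi = 1%:M /\ Psi *m Phi = 1%:M].

Lemma horizontal_constant S (Phi Psi : 'M[germ K]_3) (v : 'rV[germ K]_3) :
  map_mx (@dx K) Psi = - (conn_x S *m Psi) -> map_mx (@du K) Psi = - (conn_y S *m Psi) ->
  Psi *m Phi = 1%:M ->
  map_mx (@dx K) v = v *m conn_x S -> map_mx (@du K) v = v *m conn_y S ->
  exists k : 'rV[K]_3, v *m Psi = map_mx (@cst_germ K) k /\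
    v = map_mx (@cst_germ K) k *m Phi.
Proof.
move=> Psix Psiu PsiPhi vx vu.
have vPsi : v *m Psi = map_mx (@cst_germ K)
    (map_mx (fun g : germ K => g 0%N 0%N) (v *m Psi)).
  apply: constant_mx; rewrite (map_dxM, map_duM) (vx, vu) (Psix, Psiu) mulmxN mulmxA;
  exact: subrr.
by exists (map_mx (fun g : germ K => g 0%N 0%N) (v *m Psi)); rewrite -vPsi -mulmxA PsiPhi mulmx1.
Qed.

Lemma constant_horizontal S (Phi : 'M[germ K]_3) (k : 'rV[K]_3) :
  map_mx (@dx K) Phi = Phi *m conn_x S -> map_mx (@du K) Phi = Phi *m conn_y S ->
  map_mx (@dx K) (map_mx (@cst_germ K) k *m Phi) = map_mx (@cst_germ K) k *m Phi *m conn_x S /\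
  map_mx (@du K) (map_mx (@cst_germ K) k *m Phi) = map_mx (@cst_germ K) k *m Phi *m conn_y S.
Proof.
move=> Phix Phiu; rewrite map_dxM map_duM Phix Phiu.
have -> : map_mx (@dx K) (map_mx (@cst_germ K) k) = 0.
  by apply/rowP => j; rewrite !mxE dx_cst.
have -> : map_mx (@du K) (map_mx (@cst_germ K) k) = 0.
  by apply/rowP => j; rewrite !mxE du_cst.
by rewrite !mul0mx !add0r !mulmxA.
Qed.

Lemma frame_inverse F P Q S Phi Psi a : frame_at F P Q S Phi Psi a ->
  P a *m Q a = 1%:M.
Proof.
move=> [_ [PPhi QPsi] _ _ [PhiPsi _]].
have -> : P a = coef_mx Phi 0 0.
  by apply/matrixP => i j; rewrite mxE; exact: has_germ_center (PPhi i j).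
have -> : Q a = coef_mx Psi 0 0.
  by apply/matrixP => i j; rewrite mxE; exact: has_germ_center (QPsi i j).
have := coef_mxM Phi Psi 0 0; rewrite !big_ord1 PhiPsi /= => <-.
by apply/matrixP => i j; rewrite !mxE; case: eqP.
Qed.

End Frames.

(** * Sheaves trivialised by a frame *)

Section FrameSheaves.
Variable K : numFieldType.
Hypothesis Kcomplete : geometrically_complete K.
Variables (U : set (K * K)) (F : system (K * K -> K)) (P Q : K * K -> 'M[K]_3).
Hypothesis frames : forall a, U a -> exists S Phi Psi, frame_at F P Q S Phi Psi a.
Implicit Types (W : set (K * K)) (a b : K * K).

Let section_of (c : K * K -> 'rV[K]_3) a := lift_value F a (c a *m P a).

Lemma section_of_horizontal W c : W `<=` U ->
  locally_constant W c -> horizontal_sheaf F W (section_of c).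
Proof.
move=> WU cloc a Wa.
have [S [Phi [Psi [FS [PPhi QPsi] [Phix Phiu] _ _]]]] := frames (WU _ Wa).
exists S; split=> //; pose v := map_mx (@cst_germ K) (c a) *m Phi.
have [vx vu] := constant_horizontal (c a) Phix Phiu.
exists (Defs.pi_inv S v); first by apply/horizontal_pi_inv.
apply: (has_germs_lift Kcomplete FS) => j.
apply: (has_germ_near_at (f := fun y => (c a *m P y) 0 j)).
  by near=> b; have -> : c b = c a by near: b; exact: cloc.
exact: (has_germs_mulmx Kcomplete (has_germs_cst (c a) a) PPhi).
Unshelve. all: by end_near. Qed.

(** The last clause recovers all six values from three: [sigma] is the lift of its projection, and
    values at [a] are constant coefficients of germs. *)
Lemma horizontal_sectionP W s a : W a -> W `<=` U -> horizontal_sheaf F W s ->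
  exists S Phi Psi (k : 'rV[K]_3), [/\ frame_at F P Q S Phi Psi a,
    has_germs (fun y => one_jet (s y)) a (map_mx (@cst_germ K) k *m Phi),
    map_mx (@cst_germ K) k *m Phi *m Psi = map_mx (@cst_germ K) k &
    s a = lift_value F a (one_jet (s a))].
Proof.
move=> Wa WU /(_ a Wa)[S' [FS' [sigma hsigma ssigma]]].
have [S [Phi [Psi fr]]] := frames (WU _ Wa).
have [FS _ [Phix Phiu] [Psix Psiu] [_ PsiPhi]] := fr.
have ? : S' = S := has_system_germ_unique FS' FS; subst S'.
have [vx vu] : map_mx (@dx K) (Defs.pi_ sigma) = Defs.pi_ sigma *m conn_x S /\
    map_mx (@du K) (Defs.pi_ sigma) = Defs.pi_ sigma *m conn_y S.
  by apply/horizontal_pi_inv; rewrite pi_K.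
have [k [vPsi vE]] := horizontal_constant Psix Psiu PsiPhi vx vu.
exists S, Phi, Psi, k; split => //; first by rewrite -vE; exact: has_germs_one_jet.
  by rewrite -vE.
have := has_germs_lift Kcomplete FS (has_germs_one_jet ssigma).
have -> : lift_jet S (Defs.pi_ sigma) = jet sigma by rewrite -{2}(pi_K sigma).
by move=> /has_germs_center ->; exact: has_germs_center ssigma.
Qed.

Lemma constant_sheaf_isomorphic :
  sheaf_isomorphic U (@locally_constant K 'rV[K]_3) (horizontal_sheaf F).
Proof.
exists (fun _ => section_of); split.
- by move=> W _ WU c; exact: section_of_horizontal.
- by move=> W W' _ _ _ _ f g _ _ fg a /fg fga; rewrite /section_of fga.
- move=> W _ _ k f g _ _ a _; rewrite /section_of mulmxDl -scalemxAl.
  exact: lift_value_linear.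
- move=> W _ WU f g _ _ fg a Wa.
  have [S [Phi [Psi fr]]] := frames (WU _ Wa).
  have := congr1 (@one_jet K) (fg a Wa); rewrite /section_of !lift_valueK.
  move=> /(congr1 (mulmx^~ (Q a))).
  by rewrite -!mulmxA (frame_inverse fr) !mulmx1.
(* The inverse multiplies the 1-jet by [Q]; the result is locally constant because its germ at each
   point is a constant row. *)
- move=> W _ WU s sW; exists (fun a => one_jet (s a) *m Q a).
    move=> a Wa; have [S [Phi [Psi [k [fr sk kPsi _]]]]] := horizontal_sectionP Wa WU sW.
    have [_ [_ QPsi] _ _ _] := fr.
    have cst_k : \forall b \near a, one_jet (s b) *m Q b = k.
      have := has_germs_mulmx Kcomplete sk QPsi; rewrite kPsi => sQ.
      have near_j j : \forall b \near a, (one_jet (s b) *m Q b) 0 j = k 0 j.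
        exact: near_eq_at (sQ j) (has_germs_cst k a j).
      have near_all := @filter_forall _ 'I_3
        (fun j b => (one_jet (s b) *m Q b) 0 j = k 0 j) (nbhs a) _ near_j.
      near=> b; apply/rowP; near: b; exact: near_all.
    have -> : one_jet (s a) *m Q a = k by exact: nbhs_singleton cst_k.
    by [].
  move=> a Wa; have [S [Phi [Psi [k [fr _ _ sE]]]]] := horizontal_sectionP Wa WU sW.
  have QP : Q a *m P a = 1%:M by apply: mulmx1C; exact: frame_inverse fr.
  by rewrite /section_of -mulmxA QP mulmx1 -sE.
Unshelve. all: by end_near. Qed.

Lemma horizontal_local_system : open U -> local_system 3 U (horizontal_sheaf F).
Proof. by move=> oU a Ua; exists U; split=> //; exact: constant_sheaf_isomorphic. Qed.

(** A horizontal row is (z, dx z, du z), so equal first entries force equal rows, and multiplying by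
    [Psi] recovers the constants. *)
Lemma solution_first_entry S Phi Psi a (k k' : 'rV[K]_3) : frame_at F P Q S Phi Psi a ->
  (map_mx (@cst_germ K) k *m Phi) 0 0 = (map_mx (@cst_germ K) k' *m Phi) 0 0 -> k = k'.
Proof.
move=> [_ _ [Phix Phiu] _ [PhiPsi _]] kk'.
have [kx ku] := constant_horizontal k Phix Phiu.
have [k'x k'u] := constant_horizontal k' Phix Phiu.
have [_ kE] := horizontal_solution kx ku; have [_ k'E] := horizontal_solution k'x k'u.
have : map_mx (@cst_germ K) k *m Phi = map_mx (@cst_germ K) k' *m Phi.
  by rewrite kE k'E kk'.
move=> /(congr1 (mulmx^~ Psi)); rewrite -!mulmxA PhiPsi !mulmx1 => /rowP E.
by apply/rowP => j; have := congr1 (fun g : germ K => g 0 0)%N (E j); rewrite !mxE.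
Qed.

Lemma solution_sheaf_frame W z a : W a -> W `<=` U -> solution_sheaf F W z ->
  exists k : 'rV[K]_3, \forall b \near a, z b = (k *m P b) 0 0.
Proof.
move=> Wa WU /(_ a Wa)[S' [FS' [zeta zsol zz]]].
have [S [Phi [Psi [FS [PPhi _] _ [Psix Psiu] [_ PsiPhi]]]]] := frames (WU _ Wa).
have ? : S' = S := has_system_germ_unique FS' FS; subst S'.
have [vx vu] := solution_horizontal zsol.
have [k [_ vE]] := horizontal_constant Psix Psiu PsiPhi vx vu.
exists k; apply: (near_eq_at zz).
have := has_germs_mulmx Kcomplete (has_germs_cst k a) PPhi 0.
by rewrite -vE mxE.
Qed.

(** Surjectivity is the delicate clause: a section [z] is a bare function without chosen
    derivatives, so its jet is rebuilt from the frame, as [section_of c] with [c] locally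
    constant. *)
Lemma horizontal_solution_isomorphic : open U ->
  sheaf_isomorphic U (horizontal_sheaf F) (solution_sheaf F).
Proof.
move=> oU; exists (fun _ (s : K * K -> 'rV[K]_6) a => s a 0 0); split.
- move=> W _ _ s sW a Wa; have [S [FS [sigma hsigma ssigma]]] := sW a Wa.
  exists S; split=> //; exists (jet sigma 0 0); last exact: ssigma.
  have [vx vu] : map_mx (@dx K) (Defs.pi_ sigma) = Defs.pi_ sigma *m conn_x S /\
      map_mx (@du K) (Defs.pi_ sigma) = Defs.pi_ sigma *m conn_y S.
    by apply/horizontal_pi_inv; rewrite pi_K.
  by have [] := horizontal_solution vx vu; rewrite mxE.
- by move=> W W' _ _ _ _ f g _ _ fg a /fg ->.
- by move=> W _ _ k f g _ _ a _; rewrite !mxE.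
- move=> W oW WU f g fW gW fg a Wa.
  have [S [Phi [Psi [k [fr fk _ fE]]]]] := horizontal_sectionP Wa WU fW.
  have [S' [Phi' [Psi' [k' [fr' gk' _ gE]]]]] := horizontal_sectionP Wa WU gW.
  have ? : Phi' = Phi.
    have [_ [PPhi _] _ _ _] := fr; have [_ [PPhi' _] _ _ _] := fr'.
    by apply/matrixP => i j; exact: germ_unique (PPhi' i j) (PPhi i j).
  subst Phi'; rewrite fE gE (has_germs_center fk) (has_germs_center gk').
  suff -> : k = k' by [].
  apply: (solution_first_entry fr); apply: (@germ_unique _ _ _ _ _ (fk 0)).
  apply: has_germ_near_at (gk' 0); near=> b; rewrite !mxE /= fg //.
  by near: b; exact: open_nbhs_nbhs.
- move=> W oW WU z zW.
  (* The row is chosen independently at each point; local constancy is proved afterwards. *)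
  have [c cP] : exists c : K * K -> 'rV[K]_3,
      forall a, W a -> \forall b \near a, z b = (c a *m P b) 0 0.
    have /choice[c cP] : forall a, exists k : 'rV[K]_3,
        W a -> \forall b \near a, z b = (k *m P b) 0 0.
      move=> a; have [Wa|nWa] := pselect (W a); last by exists 0.
      by have [k kP] := solution_sheaf_frame Wa WU zW; exists k.
    by exists c.
  exists (section_of c); last first.
    by move=> a Wa; rewrite mxE /=; apply/esym; exact: nbhs_singleton (cP a Wa).
  apply: section_of_horizontal => // a Wa.
  near=> b; have Wb : W b by near: b; exact: open_nbhs_nbhs.
  (* The neighbourhood of [a] on which [c a] represents [z] is also a neighbourhood of each nearby
     [b]. There [c a] and [c b] both represent [z], so [solution_first_entry] makes them equal. *)
  have zb : \forall y \near b, z y = (c a *m P y) 0 0.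
    by near: b; apply: nbhs_interior; exact: cP.
  have [S [Phi [Psi fr]]] := frames (WU _ Wb); have [_ [PPhi _] _ _ _] := fr.
  apply: (solution_first_entry fr).
  apply: (@germ_unique _ z b).
    apply: has_germ_near_at (has_germs_mulmx Kcomplete (has_germs_cst (c b) b) PPhi 0).
    by apply: filterS (cP b Wb) => y ->.
  apply: has_germ_near_at (has_germs_mulmx Kcomplete (has_germs_cst (c a) b) PPhi 0).
  by apply: filterS zb => y ->.
Unshelve. all: by end_near. Qed.

End FrameSheaves.

Definition map_system (A B : Type) (f : A -> B) (S : system A) : system B :=
  System (f (p1 S)) (f (p2 S)) (f (p3 S)) (f (q1 S)) (f (q2 S)) (f (q3 S))
         (f (r1 S)) (f (r2 S)) (f (r3 S)).

(** * Transport of the frame from the origin to nearby points *)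

Section GlobalFrame.
Variable K : numFieldType.
Hypothesis Kcomplete : geometrically_complete K.
Implicit Types (h : K * K) (S : system (germ K)).

Lemma near_map_mx m n (T : Type) (A : 'M[T]_(m, n)) (B : K * K -> 'M[T]_(m, n)) 
    (f : K * K -> T -> T) :
  (forall i j, \forall h \near (0 : K * K), f h (A i j) = B h i j) ->
  \forall h \near (0 : K * K), map_mx (f h) A = B h.
Proof.
move=> fA; have near_all := @filter_forall2 _ 'I_m 'I_n
  (fun i j h => f h (A i j) = B h i j) (nbhs (0 : K * K)) _ fA.
near=> h; apply/matrixP => i j; rewrite mxE; move: i j; near: h; exact: near_all.
Unshelve. all: by end_near. Qed.

Lemma near_recentre_map_dx n (A : 'M[germ K]_n) : \forall h \near (0 : K * K),
  map_mx (recentre h) (map_mx (@dx K) A) = map_mx (@dx K) (map_mx (recentre h) A).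
Proof.
apply: near_map_mx => i j; near=> h; rewrite !mxE; near: h; exact: near_recentre_dx.
Unshelve. all: by end_near. Qed.

Lemma near_recentre_map_du n (A : 'M[germ K]_n) : \forall h \near (0 : K * K),
  map_mx (recentre h) (map_mx (@du K) A) = map_mx (@du K) (map_mx (recentre h) A).
Proof.
apply: near_map_mx => i j; near=> h; rewrite !mxE; near: h; exact: near_recentre_du.
Unshelve. all: by end_near. Qed.

Lemma near_recentre_mxN n (A : 'M[germ K]_n) : \forall h \near (0 : K * K),
  map_mx (recentre h) (- A) = - map_mx (recentre h) A.
Proof.
apply: near_map_mx => i j; near=> h; rewrite !mxE; near: h; exact: near_recentreN.
Unshelve. all: by end_near. Qed.

Lemma near_recentre_mx1 n : \forall h \near (0 : K * K),
  map_mx (recentre h) (1%:M : 'M[germ K]_n) = 1%:M.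
Proof.
apply: near_map_mx => i j; rewrite !mxE; case: eqP => _; exact: recentre_cst.
Qed.

Lemma near_recentre_row3 (c0 c1 c2 : germ K) (d0 d1 d2 : K * K -> germ K) :
  (\forall h \near (0 : K * K), recentre h c0 = d0 h) ->
  (\forall h \near (0 : K * K), recentre h c1 = d1 h) ->
  (\forall h \near (0 : K * K), recentre h c2 = d2 h) ->
  \forall h \near (0 : K * K), forall k,
    recentre h (mkrow 3 [:: c0; c1; c2] 0 k) = mkrow 3 [:: d0 h; d1 h; d2 h] 0 k.
Proof.
move=> cd0 cd1 cd2; near=> h; apply: ord3P; rewrite !mxE [_`_ _]/= [in RHS]/=; by near: h.
Unshelve. all: by end_near. Qed.

Lemma near_recentre_conn_x S : \forall h \near (0 : K * K),
  map_mx (recentre h) (conn_x S) = conn_x (map_system (recentre h) S).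
Proof.
have n10 := near_recentre_row3 (recentre_cst Kcomplete 0) (recentre_cst Kcomplete 1)
  (recentre_cst Kcomplete 0).
have n20 := near_recentre_row3 (near_recentreN Kcomplete (r3 S))
  (near_recentreN Kcomplete (p3 S)) (near_recentreN Kcomplete (q3 S)).
have n11 := near_recentre_row3 (near_recentreN Kcomplete (r2 S))
  (near_recentreN Kcomplete (p2 S)) (near_recentreN Kcomplete (q2 S)).
near=> h; apply/matrixP => k; apply: ord3P; rewrite [LHS]mxE [X in recentre h X]mxE [RHS]mxE.
- by rewrite [_`_ _]/=; move: k; near: h; exact: n10.
- by move: k; near: h; exact: n20.
- by move: k; near: h; exact: n11.
Unshelve. all: by end_near. Qed.

Lemma near_recentre_conn_y S : \forall h \near (0 : K * K),
  map_mx (recentre h) (conn_y S) = conn_y (map_system (recentre h) S).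
Proof.
have n01 := near_recentre_row3 (recentre_cst Kcomplete 0) (recentre_cst Kcomplete 0)
  (recentre_cst Kcomplete 1).
have n11 := near_recentre_row3 (near_recentreN Kcomplete (r2 S))
  (near_recentreN Kcomplete (p2 S)) (near_recentreN Kcomplete (q2 S)).
have n02 := near_recentre_row3 (near_recentreN Kcomplete (r1 S))
  (near_recentreN Kcomplete (p1 S)) (near_recentreN Kcomplete (q1 S)).
near=> h; apply/matrixP => k; apply: ord3P; rewrite [LHS]mxE [X in recentre h X]mxE [RHS]mxE.
- by move: k; near: h; exact: n01.
- by move: k; near: h; exact: n11.
- by move: k; near: h; exact: n02.
Unshelve. all: by end_near. Qed.

Lemma near_has_system_germ S : \forall h \near (0 : K * K),
  has_system_germ (map_system (fun g => germ_fun g) S) h (map_system (recentre h) S).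
Proof.
have near_germ g := near_has_germ_fun Kcomplete g.
apply: filterS (filterI (filterI (filterI (near_germ (p1 S)) (near_germ (p2 S))) (near_germ (p3 S)))
  (filterI (filterI (filterI (near_germ (q1 S)) (near_germ (q2 S))) (near_germ (q3 S)))
  (filterI (filterI (near_germ (r1 S)) (near_germ (r2 S))) (near_germ (r3 S))))) => h.
move=> [[[P1 P2] P3] [[[Q1 Q2] Q3] [[R1 R2] R3]]].
exact: (conj (And3 P1 P2 P3) (conj (And3 Q1 Q2 Q3) (And3 R1 R2 R3))).
Qed.

Lemma near_has_germ_mx m n (A : 'M[germ K]_(m, n)) : \forall h \near (0 : K * K),
  forall i j, has_germ (fun y => map_mx (fun g => germ_fun g y) A i j) h
    (map_mx (recentre h) A i j).
Proof.
apply: (@filter_forall2 _ 'I_m 'I_n (fun i j h =>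
  has_germ (fun y => map_mx (fun g => germ_fun g y) A i j) h
    (map_mx (recentre h) A i j)) (nbhs (0 : K * K)) _) => i j.
near=> h; rewrite mxE; under eq_fun do rewrite mxE; near: h; exact: near_has_germ_fun.
Unshelve. all: by end_near. Qed.

(** A frame is defined by finitely many germ identities, so the neighbourhoods on which recentring
    preserves each of them have a common one. *)
Lemma near_frame S (Phi Psi : 'M[germ K]_3) :
  map_mx (@dx K) Phi = Phi *m conn_x S -> map_mx (@du K) Phi = Phi *m conn_y S ->
  map_mx (@dx K) Psi = - (conn_x S *m Psi) -> map_mx (@du K) Psi = - (conn_y S *m Psi) ->
  Phi *m Psi = 1%:M -> Psi *m Phi = 1%:M ->
  \forall h \near (0 : K * K), frame_at (map_system (fun g => germ_fun g) S)
    (fun y => map_mx (fun g => germ_fun g y) Phi)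
    (fun y => map_mx (fun g => germ_fun g y) Psi)
    (map_system (recentre h) S) (map_mx (recentre h) Phi) (map_mx (recentre h) Psi) h.
Proof.
move=> Phix Phiu Psix Psiu PhiPsi PsiPhi.
have mul := @near_recentre_mulmx K Kcomplete 3 3 3.
have mulA := mul Phi (conn_x S); have mulB := mul Phi (conn_y S).
have mulC := mul (conn_x S) Psi; have mulD := mul (conn_y S) Psi.
have mulPQ := mul Phi Psi; have mulQP := mul Psi Phi.
have oppC := near_recentre_mxN (conn_x S *m Psi).
have oppD := near_recentre_mxN (conn_y S *m Psi).
have dxP := near_recentre_map_dx Phi; have duP := near_recentre_map_du Phi.
have dxQ := near_recentre_map_dx Psi; have duQ := near_recentre_map_du Psi.
have cx := near_recentre_conn_x S; have cy := near_recentre_conn_y S.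
have rec1 := near_recentre_mx1 3.
have germS := near_has_system_germ S.
have germP := near_has_germ_mx Phi; have germQ := near_has_germ_mx Psi.
rewrite Phix in dxP; rewrite Phiu in duP; rewrite Psix in dxQ; rewrite Psiu in duQ.
rewrite PhiPsi in mulPQ; rewrite PsiPhi in mulQP.
apply: filterS (filterI mulA (filterI mulB (filterI mulC (filterI mulD (filterI mulPQ
  (filterI mulQP (filterI oppC (filterI oppD (filterI dxP (filterI duP (filterI dxQ
  (filterI duQ (filterI cx (filterI cy (filterI rec1 (filterI germS
  (filterI germP germQ))))))))))))))))) => h.
move=> [mA [mB [mC [mD [mPQ [mQP [oC [oD [xP [uP [xQ [uQ [ex [ey [e1 [gS [gP gQ]]]]]]]]]]]]]]]]].
split; [exact: gS|by split|split|split|split].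
- by rewrite -xP mA ex.
- by rewrite -uP mB ey.
- by rewrite -xQ oC mC ex.
- by rewrite -uQ oD mD ey.
- by rewrite -mPQ e1.
- by rewrite -mQP e1.
Qed.

End GlobalFrame.

(** * Solution germs at the origin *)

Section Solutions.
Variables (K : numFieldType) (S : system (germ K)) (Phi Psi : 'M[germ K]_3).
Hypothesis (Phix : map_mx (@dx K) Phi = Phi *m conn_x S)
  (Phiu : map_mx (@du K) Phi = Phi *m conn_y S)
  (Psix : map_mx (@dx K) Psi = - (conn_x S *m Psi))
  (Psiu : map_mx (@du K) Psi = - (conn_y S *m Psi))
  (PhiPsi : Phi *m Psi = 1%:M) (PsiPhi : Psi *m Phi = 1%:M).

Definition combination (M : 'M[germ K]_3) (c : 'rV[K]_3) : germ K :=
  (map_mx (@cst_germ K) c *m M) 0 0.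

Lemma combination_is_linear M : linear (combination M).
Proof.
move=> k c d; rewrite /combination !mxE scaler_sumr -big_split /=.
apply: eq_bigr => i _; rewrite !mxE !cst_germE scalerDl mulrDl -scalerA.
by rewrite !scalerAl.
Qed.
HB.instance Definition _ M :=
  GRing.isLinear.Build K 'rV[K]_3 (germ K) *:%R (combination M) (combination_is_linear M).

Lemma combination_bij :
  set_bij [set: 'rV[K]_3] [set z | is_solution S z] (combination Phi).
Proof.
split.
- move=> c _; have [vx vu] := constant_horizontal c Phix Phiu.
  by have [] := horizontal_solution vx vu.
- move=> c d _ _ cd; have [cx cu] := constant_horizontal c Phix Phiu.
  have [dx_ du_] := constant_horizontal d Phix Phiu.
  have [_ cE] := horizontal_solution cx cu; have [_ dE] := horizontal_solution dx_ du_.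
  have : map_mx (@cst_germ K) c *m Phi = map_mx (@cst_germ K) d *m Phi.
    by rewrite cE dE -[(_ *m _) 0 0]/(combination Phi c) cd.
  move=> /(congr1 (mulmx^~ Psi)); rewrite -!mulmxA PhiPsi !mulmx1 => /rowP E.
  by apply/rowP => j; have := congr1 (fun g : germ K => g 0 0)%N (E j); rewrite !mxE.
- move=> z zsol; have [vx vu] := solution_horizontal zsol.
  have [k [_ vE]] := horizontal_constant Psix Psiu PsiPhi vx vu.
  by exists k => //; rewrite /combination -vE mxE.
Qed.

(** A horizontal section is the lift of (z, dx z, du z) for its first entry z, and every solution
    lifts in this way. *)
Lemma horizontal_bij : set_bij [set s : R0 S | horizontal (nabla0 S) s]
  [set z | is_solution S z] (fun s => jet s 0 0).
Proof.
have horizontalP (s : R0 S) : horizontal (nabla0 S) s -> is_solution S (jet s 0 0) /\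
    s = Defs.pi_inv S (mkrow 3 [:: jet s 0 0; dx (jet s 0 0); du (jet s 0 0)]).
  rewrite -{1}(pi_K s) => /horizontal_pi_inv[vx vu].
  by have := horizontal_solution vx vu; rewrite mxE /= => -[? vE]; rewrite -vE pi_K.
split.
- by move=> s /horizontalP[].
- by move=> s t /set_mem/horizontalP[_ sE] /set_mem/horizontalP[_ tE] st; rewrite sE tE st.
- move=> z zsol; exists (Defs.pi_inv S (mkrow 3 [:: z; dx z; du z])).
    by apply/horizontal_pi_inv; exact: solution_horizontal.
  by rewrite !mxE /= ?mxE.
Qed.

End Solutions.

Theorem theorem2p1 (R : realType) (S : system (germ (CC R))) :
  [/\ free_of_rank (R0 S) 3 /\ is_connection (nabla0 S),
      flat (nabla0 S) <-> integrability_conditions S &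
      flat (nabla0 S) ->
      (exists (U : set (CC R * CC R)) (F : system (CC R * CC R -> CC R)),
        [/\ open U /\ U 0,
            has_system_germ F 0 S /\
              (forall a, U a -> exists Sa, has_system_germ F a Sa),
            local_system 3 U (horizontal_sheaf F) &
            sheaf_isomorphic U (horizontal_sheaf F) (solution_sheaf F)]) /\
      (exists phi : R0 S -> germ (CC R),
        (forall (k : CC R) (s t : R0 S),
          phi (k%:A *: s + t) = k *: phi s + phi t) /\
        set_bij [set s | horizontal (nabla0 S) s]
          [set z | is_solution S z] phi) /\
      (exists psi : {linear 'rV[CC R]_3 -> germ (CC R)},
        set_bij [set: 'rV[CC R]_3] [set z | is_solution S z] psi)].
Proof.
split; [by split; [exact: R0_free|exact: nabla0_connection]|exact: flat_integrability|].
move=> /flat_conn_curvature/subr0_eq flatS; have complete := @CC_geometrically_complete R.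
have [Phi [Phix Phiu Phi0]] := fundamental_system flatS.
have [Psi [Psix Psiu PhiPsi PsiPhi]] := fundamental_inverse flatS Phix Phiu Phi0.
split; last split.
- pose F := map_system (fun g => germ_fun g) S.
  pose P y := map_mx (fun g => germ_fun g y) Phi.
  pose Q y := map_mx (fun g => germ_fun g y) Psi.
  have nearF := near_frame complete Phix Phiu Psix Psiu PhiPsi PsiPhi.
  (* Frames are only known to exist on a neighbourhood of 0; its interior is the open set [U]. *)
  pose V : set (CC R * CC R) := [set h | exists Sh Phih Psih, frame_at F P Q Sh Phih Psih h].
  have V0 : nbhs (0 : CC R * CC R) V.
    by apply: filterS nearF => h fr; do 3 eexists; exact: fr.
  have frames a : V^° a -> exists Sa Phia Psia, frame_at F P Q Sa Phia Psia a.
    exact: (@interior_subset _ V a).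
  exists V^°, F; split.
  + by split; [exact: open_interior|exact: nbhs_singleton (nbhs_interior V0)].
  + split; last by move=> a /frames[Sa [? [? []]]]; exists Sa.
    by split; last split; split; exact: has_germ_fun.
  + exact: horizontal_local_system frames (@open_interior _ V).
  + exact: horizontal_solution_isomorphic frames (@open_interior _ V).
- exists (fun s => jet s 0 0); split; last exact: horizontal_bij.
  (* Scalars act on [R0 S] through constant germs, hence [k%:A] on one side and the action on germs
     on the other. *)
  by move=> k s t; rewrite !mxE -scalerAl mul1r.
- by exists (combination Phi); exact: combination_bij Phix Phiu Psix Psiu PhiPsi PsiPhi.
Qed.
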